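(* Every spline $S \in \mathbb{S}_3^{\mathrm R}(\Delta_{\mathrm{PS}})$ possesses the following $C^2$ smoothness properties. (1) For every triangle $t_{ijk} \in T_{\mathrm S}$, the restriction of $S$ to $t_{ijk}$ is $C^2$ smooth. (2) For every triangle $t_{ijk} \in T \setminus T_{\mathrm S}$, the restriction of $S$ to $t_{ijk}$ is $C^2$ smooth across $[v_{ij}, v_{ijk}]$, $[v_{jk}, v_{ijk}]$, $[v_{ki}, v_{ijk}]$ and at $v_{ijk}$.
   Context: Triangulation. $\Omega\subset\mathbb{R}^2$ is a polygonal domain and $\Delta=(V,E,T)$ is a triangulation of it: $V=\{v_i\}$ is a finite set of vertices (points), $E=\{e_{ij}\}$ a finite set of edges $e_{ij}=[v_i,v_j]$ and $T=\{t_{ijk}\}$ a finite set of nondegenerate triangles $t_{ijk}=[v_i,v_j,v_k]$, where $[\cdot]$ denotes the convex hull. The union of the triangles is $\Omega$, two different triangles intersect in the empty set, an element of $V$ or an element of $E$, and every vertex and edge belongs to at least one triangle. $E^b\subseteq E$ is the set of edges on the boundary of $\Omega$; an edge of $E\setminus E^b$ is shared by two triangles, an edge of $E^b$ belongs to one. Index convention: indices not separated by a comma may be permuted ($a_{ij}=a_{ji}$, $a_{ij,k}=a_{ji,k}$), while the order of comma-separated indices matters. Powell--Sabin refinement. $\Delta_{\mathrm{PS}}=(V_{\mathrm{PS}},E_{\mathrm{PS}},T_{\mathrm{PS}})$ is obtained as follows. A split point $v_{ijk}$ is chosen inside each $t_{ijk}\in T$ so that for every interior edge $e_{ij}$ shared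 by $t_{ijk},t_{ijk'}\in T$ the segment $[v_{ijk},v_{ijk'}]$ intersects $e_{ij}$ in a point $v_{ij}$ inside $e_{ij}$; for $e_{ij}\in E^b$, $v_{ij}$ is an arbitrary point inside $e_{ij}$. Each $t_{ijk}$ is split into six triangles: $t_{i,j,k}=[v_i,v_{ij},v_{ijk}]$ and the triangles $t_{j,i,k},t_{j,k,i},t_{k,j,i},t_{k,i,j},t_{i,k,j}$ defined by the same rule ($t_{a,b,c}=[v_a,v_{ab},v_{abc}]$). These form $T_{\mathrm{PS}}$. Also $e_{i,j}=[v_i,v_{ij}]$, and $E^b_{\mathrm{PS}}$ is the set of all such half-edges $e_{i,j},e_{j,i}$ with $e_{ij}\in E^b$. Blossom. $\mathbb{P}_3$ is the space of bivariate polynomials of total degree at most 3. For $P\in\mathbb{P}_3$, the blossom $\mathcal{B}[P]:(\mathbb{R}^2)^3\to\mathbb{R}$ is the unique symmetric map that is affine in each argument and satisfies $\mathcal{B}[P](p,p,p)=P(p)$. For a spline $S$, $\mathcal{B}[S|_{t}]$ is the blossom of the polynomial coinciding with $S$ on $t$; for a half-edge $e_{i,j}\in E^b_{\mathrm{PS}}$, $\mathcal{B}[S|_{e_{i,j}}](v_i,v_j,v_{ij})$ is the blossom of the polynomial piece on the triangle of $T_{\mathrm{PS}}$ containing $e_{i,j}$. Spline space and its basis. $\mathbb{S}_3^1(\Delta_{\mathrm{PS}})=\{S\in C^1(\Omega): S|_{t}\in\mathbb{P}_3 \text{ for all } t\in T_{\mathrm{PS}}\}$. For each $v_i\in V$ fix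 a triangle $[q^v_{i,1},q^v_{i,2},q^v_{i,3}]$ containing $v_i$, all points $\frac23v_i+\frac13v_{ijk}$ ($t_{ijk}\in T$ with vertex $v_i$) and all points $\frac23v_i+\frac13v_{ij}$ ($e_{ij}\in E$ with endpoint $v_i$). Define the functionals $\beta^v_{i,r}(S)=\mathcal{B}[S|_{t_{i,j,k}}](v_i,v_i,v_i+3(q^v_{i,r}-v_i))$ for $v_i\in V$, $r=1,2,3$ (with any $t_{i,j,k}\in T_{\mathrm{PS}}$ having a vertex at $v_i$; independent of the choice); $\beta^t_{i,j,k}(S)=\mathcal{B}[S|_{t_{i,j,k}}](v_i,v_j,v_{ijk})$ for $t_{i,j,k}\in T_{\mathrm{PS}}$; $\beta^e_{i,j}(S)=\mathcal{B}[S|_{e_{i,j}}](v_i,v_j,v_{ij})$ for $e_{i,j}\in E^b_{\mathrm{PS}}$. It is known that these functionals form a basis of the dual space of $\mathbb{S}_3^1(\Delta_{\mathrm{PS}})$; let $B^v_{i,r}$, $B^t_{i,j,k}$, $B^e_{i,j}$ be the corresponding dual basis of $\mathbb{S}_3^1(\Delta_{\mathrm{PS}})$ (each function has value 1 under its own functional and 0 under all the others). Symmetric triangles. $T_{\mathrm S}\subseteq T$ is the set of symmetrically refined triangles $t_{ijk}$, i.e. those for which each of the triples $(v_k,v_{ijk},v_{ij})$, $(v_j,v_{ijk},v_{ki})$, $(v_i,v_{ijk},v_{jk})$ is collinear. Combined functions. For $e_{ij}\in E$ and a triangle $t_{ijk}$ attached to $e_{ij}$ put $w_{ij,k}=v_k$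 if $t_{ijk}\in T_{\mathrm S}$ and $w_{ij,k}=v_{ijk}$ otherwise. If $e_{ij}\in E\setminus E^b$ is shared by $t_{ijk},t_{ijk'}$, let $\omega_{ij,k},\omega_{ij,k'}\in[0,1]$ satisfy $v_{ijk}=(1-\omega_{ij,k})w_{ij,k}+\omega_{ij,k}w_{ij,k'}$ and $v_{ijk'}=(1-\omega_{ij,k'})w_{ij,k'}+\omega_{ij,k'}w_{ij,k}$, and set $B^e_{ij,k}=(1-\omega_{ij,k})(B^t_{i,j,k}+B^t_{j,i,k})+\omega_{ij,k'}(B^t_{i,j,k'}+B^t_{j,i,k'})$ (and $B^e_{ij,k'}$ by exchanging $k$ and $k'$). If $e_{ij}\in E^b$ belongs to $t_{ijk}$, let $\omega_{ij,k}\in[0,1]$ satisfy $v_{ijk}=(1-\omega_{ij,k})w_{ij,k}+\omega_{ij,k}v_{ij}$, and set $B^e_{ij,k}=(1-\omega_{ij,k})(B^t_{i,j,k}+B^t_{j,i,k})$ and $B^e_{ij}=(B^e_{i,j}+B^e_{j,i})+\omega_{ij,k}(B^t_{i,j,k}+B^t_{j,i,k})$. For $t_{ijk}\in T_{\mathrm S}$ set $B^t_{ijk}=B^e_{ij,k}+B^e_{jk,i}+B^e_{ki,j}$. Reduced space. Let $T^e_{ij}\subseteq T$ be the set of triangles attached to $e_{ij}$. The set $\mathcal{S}_{\mathrm R}$ consists of: $B^v_{i,r}$ for $v_i\in V$, $r\in\{1,2,3\}$; $B^t_{ijk}$ for $t_{ijk}\in T_{\mathrm S}$; $B^e_{ij,k}$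 for $e_{ij}\in E$ and $t_{ijk}\in T^e_{ij}\setminus T_{\mathrm S}$; $B^e_{ij}$ for $e_{ij}\in E^b$. $\mathbb{S}_3^{\mathrm R}(\Delta_{\mathrm{PS}})$ is the vector space spanned by $\mathcal{S}_{\mathrm R}$. Smoothness. A spline is $C^2$ smooth across an edge of $\Delta_{\mathrm{PS}}$ if the polynomial pieces on the two triangles of $T_{\mathrm{PS}}$ sharing it have equal partial derivatives up to order 2 along it; it is $C^2$ smooth at $v_{ijk}$ if all six polynomial pieces on $t_{ijk}$ have equal partial derivatives up to order 2 at $v_{ijk}$; its restriction to $t_{ijk}\in T$ is $C^2$ smooth if it is $C^2$ across all six edges of $\Delta_{\mathrm{PS}}$ interior to $t_{ijk}$ (those joining $v_{ijk}$ to $v_i,v_j,v_k,v_{ij},v_{jk},v_{ki}$). *)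

(* Defs.v *)
From HB Require Import structures.
From mathcomp Require Import all_boot all_order all_algebra.
From mathcomp Require Import all_classical all_reals all_analysis.
(* The notations of mpoly clash with those of MathComp-Analysis. *)
From mathcomp Require Import -(notations) mpoly.

Set Implicit Arguments.
Unset Strict Implicit.
Unset Printing Implicit Defensive.

Import Order.TTheory GRing.Theory Num.Theory numFieldNormedType.Exports.

Local Open Scope classical_set_scope.
Local Open Scope ring_scope.

Notation plane R := 'rV[R]_2.

Section Plane.
Variable R : realType.
Implicit Types (a b c x y : plane R) (s : seq (plane R)) (D : set (plane R)).

Definition hull s : set (plane R) :=
  [set x | exists w : nat -> R,
     [/\ forall l, 0 <= w l, \sum_(l < size s) w l = 1
       & x = \sum_(l < size s) w l *: s`_l]].

(* The relative interior of [hull s] when the points of [s] are affinely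
   independent: all the barycentric coordinates are positive. *)
Definition open_hull s : set (plane R) :=
  [set x | exists w : nat -> R,
     [/\ forall l, 0 < w l, \sum_(l < size s) w l = 1
       & x = \sum_(l < size s) w l *: s`_l]].

Definition collinear a b c : bool :=
  \det (\matrix_(i < 2, j < 2) (if i == 0 then b - a else c - a) 0 j) == 0.

Definition boundary D : set (plane R) := closure D `\` interior D.

(* C^1 on a closed set: [G] is the gradient of [f], and the remainder
   f y - f x - G x . (y - x) is o(|y - x|) as y tends to x within [D]. *)
Definition C1_on D (f : plane R -> R) : Prop :=
  exists G : plane R -> plane R,
    {within D, continuous G} /\
    forall x, D x -> forall e : R, 0 < e ->
      \forall y \near within D (nbhs x),
        `|f y - f x - \sum_(l < 2) G x 0 l * (y - x) 0 l| <= e * `|y - x|.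

Definition span_on D (A : set (plane R -> R)) : set (plane R -> R) :=
  [set f | exists n (a : 'I_n -> R) (g : 'I_n -> plane R -> R),
     (forall l, A (g l)) /\ forall x, D x -> f x = \sum_(l < n) a l * g l x].

Definition peval (p : mpoly 2 R) x : R := meval (x 0) p.

Definition cubic (p : mpoly 2 R) : Prop := (mmeasure mdeg p <= 4)%N.

Definition affine_map (f : plane R -> R) : Prop :=
  forall (a : R) x y, f ((1 - a) *: x + a *: y) = (1 - a) * f x + a * f y.

Definition is_blossom (p : mpoly 2 R) (b : plane R -> plane R -> plane R -> R) :
    Prop :=
  [/\ forall x y z, b x y z = b y x z /\ b x y z = b x z y,
      forall y z, affine_map (fun x => b x y z),
      forall x z, affine_map (fun y => b x y z),
      forall x y, affine_map (fun z => b x y z)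
    & forall x, b x x x = peval p x].

Definition blossom (p : mpoly 2 R) : plane R -> plane R -> plane R -> R :=
  xget (fun _ _ _ => 0) [set b | is_blossom p b].

Definition is_piece (f : plane R -> R) D (p : mpoly 2 R) : Prop :=
  cubic p /\ forall x, D x -> f x = peval p x.

(* The cubic polynomial that coincides with [f] on the triangle [D]
   (meaningful when there is one, as for splines on their triangles). *)
Definition piece (f : plane R -> R) D : mpoly 2 R := xget 0 [set p | is_piece f D p].

(* The pieces of [f] on [D] and [D'] have equal partial derivatives up to
   order 2 at [x]. *)
Definition eq_2jet (f : plane R -> R) D D' x : Prop :=
  forall m : multinom 2, (mdeg m <= 2)%N ->
    peval (mderivm m (piece f D)) x = peval (mderivm m (piece f D')) x.

End Plane.

(* [set i; j; k] now denotes a finite set; classical sets are marked %classic. *)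
Local Open Scope set_scope.
Local Open Scope ring_scope.

(* Vertices are indexed by a finite type; v_i is [pos D i], the edge e_ij is the
   set [set i; j] and the triangle t_ijk the set [set i; j; k], so that
   permutations of indices are immaterial. *)
Record mesh (R : realType) (V : finType) := Mesh {
  pos : V -> plane R ;
  edges : {set {set V}} ;
  tris : {set {set V}} }.

Section Mesh.
Variables (R : realType) (V : finType) (D : mesh R V).
Implicit Types (i j k : V) (e t : {set V}).

Definition cell (s : {set V}) : set (plane R) := hull [seq pos D i | i in s].

Definition Omega : set (plane R) :=
  [set x | exists2 t, t \in tris D & cell t x]%classic.

Definition bedges : {set {set V}} :=
  [set e in edges D | `[< cell e `<=` boundary Omega >]].

Record is_triangulation : Prop := IsTriangulation {
  pos_inj : injective (pos D) ;
  card_edge : forall e, e \in edges D -> #|e| = 2%N ;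
  card_tri : forall t, t \in tris D -> #|t| = 3%N ;
  tri_nondegenerate : forall i j k, [set i; j; k] \in tris D ->
    ~~ collinear (pos D i) (pos D j) (pos D k) ;
  tri_sides : forall t e, t \in tris D -> e \subset t -> #|e| = 2%N ->
    e \in edges D ;
  vertex_in_tri : forall i, exists2 t, t \in tris D & i \in t ;
  edge_in_tri : forall e, e \in edges D -> exists2 t, t \in tris D & e \subset t ;
  tri_meet : forall t t', t \in tris D -> t' \in tris D -> t != t' ->
    [\/ cell t `&` cell t' = set0,
        exists2 i, i \in t :&: t' & cell t `&` cell t' = [set pos D i]%classic
      | exists2 e, (e \in edges D) && (e \subset t :&: t') &
          cell t `&` cell t' = cell e] ;
  interior_edge : forall e, e \in edges D :\: bedges ->
    #|[set t in tris D | e \subset t]| = 2%N ;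
  boundary_edge : forall e, e \in bedges ->
    #|[set t in tris D | e \subset t]| = 1%N }.

End Mesh.

(* [split_pt t] is the split point v_ijk of the triangle t = {i, j, k}; [edge_pt e] is
   the point v_ij on the edge e = {i, j}. *)
Record ps_points (R : realType) (V : finType) := PSPoints {
  split_pt : {set V} -> plane R ;
  edge_pt : {set V} -> plane R }.

(* Indices of the functionals beta^v_{i,r}, beta^t_{i,j,k}, beta^e_{i,j} and of
   the corresponding basis functions. *)
Variant dof (V : Type) :=
  | Dv of V & 'I_3
  | Dt of V & V & V
  | De of V & V.

Section PowellSabin.
Variables (R : realType) (V : finType) (D : mesh R V) (P : ps_points R V).
Implicit Types (i j k : V) (e t : {set V}) (S : plane R -> R).

Local Notation v := (pos D).
Local Notation vt := (split_pt P).
Local Notation ve := (edge_pt P).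

Record is_PS_refinement : Prop := IsPSRefinement {
  split_inside : forall t, t \in tris D ->
    open_hull [seq v i | i in t] (vt t) ;
  cut_inside : forall e, e \in edges D -> open_hull [seq v i | i in e] (ve e) ;
  cut_interior : forall e t t', e \in edges D :\: bedges D ->
    t \in tris D -> t' \in tris D -> t != t' -> e \subset t -> e \subset t' ->
    hull [:: vt t; vt t'] `&` cell D e = [set ve e]%classic }.

(* The triangle t_{i,j,k}; it belongs to T_PS when {i, j, k} is in T. *)
Definition ps_cell i j k : set (plane R) :=
  hull [:: v i; ve [set i; j]; vt [set i; j; k]].

Definition ps_tri (s : set (plane R)) : Prop :=
  exists i j k, [set i; j; k] \in tris D /\ s = ps_cell i j k.

Definition spline S : Prop :=
  C1_on (Omega D) S /\ forall s, ps_tri s -> exists p, is_piece S s p.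

Definition ps_blossom S i j k := blossom (piece S (ps_cell i j k)).

Variable q : V -> 'I_3 -> plane R.

Definition vertex_triangles : Prop := forall i,
  [/\ ~~ collinear (q i 0) (q i 1) (q i 2%:R),
      hull [seq q i r | r : 'I_3] (v i),
      forall t, t \in tris D -> i \in t ->
        hull [seq q i r | r : 'I_3] ((2 / 3) *: v i + (1 / 3) *: vt t)
    & forall e, e \in edges D -> i \in e ->
        hull [seq q i r | r : 'I_3] ((2 / 3) *: v i + (1 / 3) *: ve e)].

Definition dof_valid (d : dof V) : bool :=
  match d with
  | Dv _ _ => true
  | Dt i j k => [set i; j; k] \in tris D
  | De i j => [set i; j] \in bedges D
  end.

(* The value of beta^v_{i,r} on a spline does not depend on the triangle t_{i,j,k}
   picked at v_i; for beta^e_{i,j}, [k] is the third vertex of the only triangle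
   attached to the boundary edge e_ij. *)
Definition beta (d : dof V) S : R :=
  match d with
  | Dv i r =>
      if [pick jk : V * V | [set i; jk.1; jk.2] \in tris D] is Some jk
      then ps_blossom S i jk.1 jk.2 (v i) (v i) (v i + 3 *: (q i r - v i))
      else 0
  | Dt i j k => ps_blossom S i j k (v i) (v j) (vt [set i; j; k])
  | De i j =>
      if [pick k | [set i; j; k] \in tris D] is Some k
      then ps_blossom S i j k (v i) (v j) (ve [set i; j])
      else 0
  end.

(* As the valid [beta d] form a basis of the dual of the spline space, these
   conditions determine the dual basis [B] (on Omega). *)
Definition is_dual_basis (B : dof V -> plane R -> R) : Prop :=
  [/\ forall d, dof_valid d -> spline (B d),
      forall d, dof_valid d -> beta d (B d) = 1
    & forall d d', dof_valid d -> dof_valid d' -> d <> d' -> beta d (B d') = 0].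

(* For t = {i, j, k}, t :\ k is the edge {i, j} opposite to k. *)
Definition sym_tris : {set {set V}} :=
  [set t in tris D | [forall k in t, collinear (v k) (vt t) (ve (t :\ k))]].

(* w_{ij,k} *)
Definition wpt i j k : plane R :=
  if [set i; j; k] \in sym_tris then v k else vt [set i; j; k].

(* [om e k] is the weight omega_{ij,k} for e = {i, j}. *)
Definition is_weights (om : {set V} -> V -> R) : Prop :=
  (forall i j k k', k != k' -> [set i; j] \in edges D :\: bedges D ->
     [set i; j; k] \in tris D -> [set i; j; k'] \in tris D ->
     0 <= om [set i; j] k <= 1 /\
     vt [set i; j; k] = (1 - om [set i; j] k) *: wpt i j k
                        + om [set i; j] k *: wpt i j k') /\
  (forall i j k, [set i; j] \in bedges D -> [set i; j; k] \in tris D ->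
     0 <= om [set i; j] k <= 1 /\
     vt [set i; j; k] = (1 - om [set i; j] k) *: wpt i j k
                        + om [set i; j] k *: ve [set i; j]).

Variables (B : dof V -> plane R -> R) (om : {set V} -> V -> R).

(* B^e_{ij,k}; k' is the third vertex of the other triangle attached to e_ij,
   if any. *)
Definition Beijk i j k : plane R -> R := fun x =>
  (1 - om [set i; j] k) * (B (Dt i j k) x + B (Dt j i k) x) +
  (if [pick k' | (k' != k) && ([set i; j; k'] \in tris D)] is Some k'
   then om [set i; j] k' * (B (Dt i j k') x + B (Dt j i k') x) else 0).

(* B^e_ij for a boundary edge e_ij attached to t_ijk *)
Definition Beij i j k : plane R -> R := fun x =>
  (B (De i j) x + B (De j i) x) +
  om [set i; j] k * (B (Dt i j k) x + B (Dt j i k) x).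

Definition Btijk i j k : plane R -> R := fun x =>
  Beijk i j k x + Beijk j k i x + Beijk k i j x.

Definition reduced_basis : set (plane R -> R) :=
  fun f => [\/ exists i r, f = B (Dv i r),
      exists i j k, [set i; j; k] \in sym_tris /\ f = Btijk i j k,
      exists i j k, [/\ [set i; j] \in edges D,
        [set i; j; k] \in tris D :\: sym_tris & f = Beijk i j k]
    | exists i j k, [/\ [set i; j] \in bedges D,
        [set i; j; k] \in tris D & f = Beij i j k]].

Definition reduced_space : set (plane R -> R) := span_on (Omega D) reduced_basis.

Definition C2_across S (e : set (plane R)) : Prop :=
  forall s s', ps_tri s -> ps_tri s' -> e `<=` s -> e `<=` s' ->
    forall x, e x -> eq_2jet S s s' x.

Definition C2_at_split S t : Prop :=
  forall i j k i' j' k', [set i; j; k] = t -> [set i'; j'; k'] = t ->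
    eq_2jet S (ps_cell i j k) (ps_cell i' j' k') (vt t).

Definition C2_on_tri S t : Prop :=
  (forall i, i \in t -> C2_across S (hull [:: v i; vt t])) /\
  (forall i j, i \in t -> j \in t -> i != j ->
     C2_across S (hull [:: ve [set i; j]; vt t])).

End PowellSabin.

(* Main.v *)
Require Import Defs.
From mathcomp Require Import all_boot all_order all_algebra.
From mathcomp Require Import all_classical all_reals all_analysis.
From mathcomp Require Import -(notations) mpoly.
From mathcomp Require Import ring lra.

(* A cubic p is determined by its blossom, and two cubics have the same 2-jet
   at x as soon as their blossoms agree at (x, y, z) for all y and z.  Being C^1
   across a segment means that the blossoms of the two pieces agree as soon as
   two of their arguments lie on the line of the segment, so C^2 smoothness
   amounts to one or two additional scalar equations.
   - Across [v_ij, v_ijk] these are the equalities beta^t_{i,j,k} = beta^t_{j,i,k}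
     and the analogous equality at v_ij, which hold in the reduced space.
   - At v_ijk, the blossoms with first argument v_ijk then form a C^1 quadratic
     spline on the Clough-Tocher split, and such a spline is a single quadratic.
   - Across [v_i, v_ijk] in a symmetric triangle, the missing equation is that of
     the values at (v_i, v_j, v_k).  By collinearity, the affine function
     z |-> blossom(v_i, v_j, z), common to both sides of e_ij, takes at v_k the
     value of the coefficient of B^e_{ij,k}, which is the same for the three edges. *)

Set Implicit Arguments.
Unset Strict Implicit.
Unset Printing Implicit Defensive.

Import Order.TTheory GRing.Theory Num.Theory numFieldNormedType.Exports.

Local Open Scope set_scope.
Local Open Scope ring_scope.

(** * Blossoms of cubics by polarization *)

Section Cubic.
Variable R : realType.
Implicit Types (F : plane R -> R) (p : mpoly 2 R) (x y z u w : plane R).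

(** The polarization identity for cubics, with $27 = 3^3$, $8 = 2^3$ and $6 = 3!$. In terms of means
    instead of sums it also covers inhomogeneous polynomials, and it evaluates [F] only inside the
    convex hull of the arguments. *)
Definition polar F x y z : R :=
  (27 * F (3^-1 *: (x + y + z))
   - 8 * (F (2^-1 *: (x + y)) + F (2^-1 *: (y + z)) + F (2^-1 *: (x + z)))
   + F x + F y + F z) / 6.

(** Identities that are linear in the polynomial reduce in this way to the ten monomials of degree
    at most 3. *)
Lemma cubic_ind (Q : mpoly 2 R -> Prop) :
  Q 0 -> (forall p1 p2, Q p1 -> Q p2 -> Q (p1 + p2)) ->
  (forall (c : R) p, Q p -> Q (c *: p)) ->
  (forall m : multinom 2, (mdeg m <= 3)%N -> Q (mpolyX R m)) ->
  forall p, cubic p -> Q p.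
Proof.
move=> Q0 QD QZ QX p; rewrite /cubic => hp; rewrite (mpolyE p) big_seq.
elim/big_rec: _ => // m s hm Qs; apply: QD => //; apply/QZ/QX.
(* [mmeasure mdeg p] is one more than the total degree, so the bound 4 in [cubic] means degree at
   most 3. *)
by have := leq_trans (mmeasure_mnm_lt mdeg hm) hp.
Qed.

Lemma mdeg2 (m : multinom 2) : mdeg m = (m 0%R + m 1%R)%N.
Proof.
by rewrite mdegE !big_ord_recl big_ord0 addn0; congr (_ + m _)%N; exact: val_inj.
Qed.

Lemma prod2 (T : comPzRingType) (f : 'I_2 -> T) : \prod_(i < 2) f i = f 0 * f 1.
Proof.
by rewrite !big_ord_recl big_ord0 mulr1; congr (_ * f _); exact: val_inj.
Qed.

Lemma pevalX m x : peval (mpolyX R m) x = x 0 0 ^+ m 0 * x 0 1 ^+ m 1.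
Proof. by rewrite /peval mevalX prod2. Qed.

Lemma pevalD p1 p2 x : peval (p1 + p2) x = peval p1 x + peval p2 x.
Proof. exact: mevalD. Qed.
Lemma pevalZ (c : R) p x : peval (c *: p) x = c * peval p x.
Proof. exact: mevalZ. Qed.
Lemma peval0 x : peval (0 : mpoly 2 R) x = 0.
Proof. exact: meval0. Qed.

Lemma polarX (m : multinom 2) x y z : polar (peval (mpolyX R m)) x y z =
  (fun f : R -> R -> R =>
    (27 * f (3^-1 * (x 0 0 + y 0 0 + z 0 0)) (3^-1 * (x 0 1 + y 0 1 + z 0 1))
     - 8 * (f (2^-1 * (x 0 0 + y 0 0)) (2^-1 * (x 0 1 + y 0 1))
            + f (2^-1 * (y 0 0 + z 0 0)) (2^-1 * (y 0 1 + z 0 1))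
            + f (2^-1 * (x 0 0 + z 0 0)) (2^-1 * (x 0 1 + z 0 1)))
     + f (x 0 0) (x 0 1) + f (y 0 0) (y 0 1) + f (z 0 0) (z 0 1)) / 6)
  (fun s t => s ^+ m 0 * t ^+ m 1).
Proof. by rewrite /polar !pevalX !mxE. Qed.

Lemma polarD p1 p2 x y z :
  polar (peval (p1 + p2)) x y z = polar (peval p1) x y z + polar (peval p2) x y z.
Proof. rewrite /polar !pevalD; ring. Qed.
Lemma polarZ (c : R) p x y z :
  polar (peval (c *: p)) x y z = c * polar (peval p) x y z.
Proof. rewrite /polar !pevalZ; ring. Qed.
Lemma polar0 x y z : polar (peval 0) x y z = 0.
Proof. rewrite /polar !peval0; ring. Qed.

Lemma polarC F x y z : polar F x y z = polar F y x z.
Proof. rewrite /polar (addrC y x); ring. Qed.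
Lemma polarAC F x y z : polar F x y z = polar F x z y.
Proof. rewrite /polar (addrC z y) (addrAC x z y); ring. Qed.

Lemma polar_diag F x : polar F x x x = F x.
Proof.
have e2 : 2^-1 *: (x + x) = x by apply/rowP => i; rewrite !mxE; field.
have e3 : 3^-1 *: (x + x + x) = x by apply/rowP => i; rewrite !mxE; field.
by rewrite /polar e2 e3; field.
Qed.

(** Both sides are linear in [p], so monomials suffice. Three points are combined at once because
    three affinely independent points determine an affine function on the plane. *)
Lemma polar_aff p (al be ga : R) x y z u w : cubic p -> al + be + ga = 1 ->
  polar (peval p) (al *: x + be *: y + ga *: z) u w =
  al * polar (peval p) x u w + be * polar (peval p) y u w
    + ga * polar (peval p) z u w.
Proof.
move=> hp sum1; have -> : al = 1 - be - ga by rewrite -sum1; ring.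
move: p hp; apply: cubic_ind.
- by rewrite !polar0; ring.
- by move=> p1 p2 h1 h2; rewrite !polarD h1 h2; ring.
- by move=> c p h; rewrite !polarZ h; ring.
move=> m; rewrite mdeg2 !polarX !mxE.
move: (m _) (m _) => a b; move: (x 0 0) (x 0 1) (y 0 0) (y 0 1) (z 0 0) (z 0 1).
move: (u 0 0) (u 0 1) (w 0 0) (w 0 1) => ? ? ? ? ? ? ? ? ? ?.
(* Exponents beyond 3 contradict the degree bound; each remaining pair gives an explicit rational
   identity. *)
do 4? [case: a => [|a]]; do 4? [case: b => [|b]];
  move=> // _; by field.
Qed.

Lemma peval_mderivmX (m n : multinom 2) x :
  peval (mderivm m (mpolyX R n)) x =
  (n 0%R ^_ m 0%R * n 1%R ^_ m 1%R)%N%:R *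
    (x 0 0 ^+ (n 0%R - m 0%R) * x 0 1 ^+ (n 1%R - m 1%R)).
Proof. rewrite mderivmX pevalZ pevalX !mnmE !big_ord_recl big_ord0 muln1.
by congr ((_ * (n _ ^_ m _))%N%:R * _); exact: val_inj. Qed.

(** The partial derivative of order [(a, b)] of a cubic at [x], as a difference of blossom values
    along the coordinate directions. The factors are $3$ and $3 \cdot 2$, and the last branch is the
    mixed derivative. One blossom argument always stays at [x]. *)
Definition jet2 F x (a b : nat) : R :=
  let B := polar F x in
  let y := x + delta_mx 0 0 in let z := x + delta_mx 0 1 in
  match a, b with
  | 0, 0 => B x x
  | 1, 0 => 3 * (B x y - B x x)
  | 0, 1 => 3 * (B x z - B x x)
  | 2, 0 => 6 * (B y y - 2 * B x y + B x x)
  | 0, 2 => 6 * (B z z - 2 * B x z + B x x)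
  | _, _ => 6 * (B y z - B x y - B x z + B x x)
  end.

Lemma mderivm_jet2 p x (m : multinom 2) : cubic p -> (mdeg m <= 2)%N ->
  peval (mderivm m p) x = jet2 (peval p) x (m 0) (m 1).
Proof.
move=> hp; rewrite mdeg2 => hm; move: p hp; apply: cubic_ind.
- rewrite linear0 peval0 /jet2 !polar0; move: (m 0) (m 1) => a b.
  by do 3? [case: a => [|a]]; do 3? [case: b => [|b]]; ring.
- move=> p1 p2 h1 h2; rewrite linearD pevalD h1 h2 /jet2 !polarD.
  by move: (m 0) (m 1) => a b; do 3? [case: a => [|a]]; do 3? [case: b => [|b]]; ring.
- move=> c p h; rewrite linearZ pevalZ h /jet2 !polarZ.
  by move: (m 0) (m 1) => a b; do 3? [case: a => [|a]]; do 3? [case: b => [|b]]; ring.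
move=> n; rewrite mdeg2 peval_mderivmX /jet2 !polarX.
have y0 : (x + delta_mx 0 0) 0 0 = x 0 0 + 1 by rewrite !mxE.
have y1 : (x + delta_mx 0 0) 0 1 = x 0 1 by rewrite !mxE addr0.
have z0 : (x + delta_mx 0 1) 0 0 = x 0 0 by rewrite !mxE addr0.
have z1 : (x + delta_mx 0 1) 0 1 = x 0 1 + 1 by rewrite !mxE.
rewrite {}y0 {}y1 {}z0 {}z1.
move: (m _) (m _) (n _) (n _) hm => a b c d; move: (x 0 0) (x 0 1) => s t.
case: a => [|[|[|a]]]; case: b => [|[|[|b]]] //= _; try by rewrite !addnS ltnS.
all: case: c => [|[|[|[|c]]]]; case: d => [|[|[|[|d]]]] //= _;
  rewrite /falling_factorial /=; by field.
Qed.

Lemma eq_mderivm p1 p2 x : cubic p1 -> cubic p2 ->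
  (forall z1 z2, polar (peval p1) x z1 z2 = polar (peval p2) x z1 z2) ->
  forall m : multinom 2, (mdeg m <= 2)%N ->
    peval (mderivm m p1) x = peval (mderivm m p2) x.
Proof. by move=> h1 h2 h m hm; rewrite !mderivm_jet2 // /jet2 !h. Qed.

End Cubic.

Section Blossom.
Variable R : realType.
Implicit Types (F : plane R -> R) (p : mpoly 2 R) (x y z u w : plane R).

Lemma is_blossom_polar p : cubic p -> is_blossom p (polar (peval p)).
Proof.
move=> hp.
have aff y z : affine_map (fun x => polar (peval p) x y z).
  move=> a x1 x2; have := @polar_aff R p (1 - a) a 0 x1 x2 0 y z hp.
  rewrite scale0r !addr0 mul0r addr0 subrK /=. exact.
split=> //.
- by move=> x y z; split; [exact: polarC | exact: polarAC].
- by move=> x z a y1 y2; rewrite /= ![polar _ x _ _]polarC; apply: aff.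
- by move=> x y a z1 z2; rewrite /= ![polar _ x y _]polarAC ![polar _ x _ _]polarC;
    apply: aff.
- by move=> x; rewrite polar_diag.
Qed.

(** Affinity and symmetry expand each diagonal value of [b] at a mean into values at triples among
    [x], [y], [z]; in the polarization formula all of them cancel except [b x y z]. *)
Lemma is_blossom_unique p b : is_blossom p b ->
  forall x y z, b x y z = polar (peval p) x y z.
Proof.
move=> [sym a1 a2 a3 diag] x y z.
have mid u w : 2^-1 *: (u + w) = (1 - 2^-1) *: u + 2^-1 *: w :> plane R.
  by rewrite scalerDr; congr (_ *: _ + _); field.
have third u1 u2 u3 : 3^-1 *: (u1 + u2 + u3) =
  (1 - 3^-1) *: ((1 - 2^-1) *: u1 + 2^-1 *: u2) + 3^-1 *: u3 :> plane R.
  by rewrite !scalerDr !scalerA; congr (_ *: _ + _ *: _ + _); field.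
rewrite /polar third !mid -!diag !(a1, a2, a3).
have sxy u1 u2 u3 : b u1 u2 u3 = b u2 u1 u3 by case: (sym u1 u2 u3).
have syz u1 u2 u3 : b u1 u2 u3 = b u1 u3 u2 by case: (sym u1 u2 u3).
(* Symmetry sorts the arguments of every term, so that equal terms become syntactically equal. *)
rewrite !(sxy y x) !(sxy z x) !(sxy z y) !(syz _ y x) !(syz _ z x) !(syz _ z y).
rewrite ?(sxy y x) ?(sxy z x) ?(sxy z y).
by field.
Qed.

Lemma blossomE p : cubic p -> blossom p = polar (peval p).
Proof.
move=> /is_blossom_polar hp.
have hb := @xgetI _ (fun _ _ _ => 0) [set b | is_blossom p b]%classic _ hp.
by apply/funext => x; apply/funext => y; apply/funext => z; exact: (is_blossom_unique hb).
Qed.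

End Blossom.

(** * Planar geometry *)

Section Geometry.
Variable R : realType.
Implicit Types (p : mpoly 2 R) (a b c x y z u w : plane R).

Definition affine_fun (f : plane R -> R) := forall (al be ga : R) x y z,
  al + be + ga = 1 ->
  f (al *: x + be *: y + ga *: z) = al * f x + be * f y + ga * f z.

(** Affine independence in its existence form: every point has barycentric coordinates. Their
    uniqueness is [noncollinear_free]. *)
Definition affine_span a b c := forall z, exists al be ga : R,
  al + be + ga = 1 /\ z = al *: a + be *: b + ga *: c.

Lemma affine_fun_eq f g a b c : affine_fun f -> affine_fun g ->
  affine_span a b c -> f a = g a -> f b = g b -> f c = g c -> f =1 g.
Proof.
move=> af ag sp fa fb fc z; have [al [be [ga [s1 ->]]]] := sp z.
by rewrite af // ag // fa fb fc.
Qed.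

Lemma sum2 (T : nmodType) (f : 'I_2 -> T) : \sum_(i < 2) f i = f 0 + f 1.
Proof.
by rewrite !big_ord_recl big_ord0 addr0; congr (_ + f _); exact: val_inj.
Qed.

Lemma row2P x y : x 0 0 = y 0 0 -> x 0 1 = y 0 1 -> x = y.
Proof.
move=> h0 h1; apply/rowP => i.
have [->|->] // : i = 0 \/ i = 1.
by case: i => -[|[|//]] hi; [left | right]; exact: val_inj.
Qed.

Lemma hull2P a b x : hull [:: a; b] x <->
  exists al be : R, [/\ 0 <= al, 0 <= be, al + be = 1 & x = al *: a + be *: b].
Proof.
split=> [[w [w0 w1 ->]]|[al [be [h1 h2 h3 ->]]]].
  exists (w 0%N), (w 1%N); rewrite !big_ord_recl !big_ord0 /= !addr0 in w1 *.
  by split.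
exists (fun n => if n is 0%N then al else be).
by rewrite !big_ord_recl !big_ord0 /= !addr0; split=> // -[].
Qed.

Lemma hull3P a b c x : hull [:: a; b; c] x <->
  exists al be ga : R, [/\ 0 <= al, 0 <= be, 0 <= ga, al + be + ga = 1
    & x = al *: a + be *: b + ga *: c].
Proof.
split=> [[w [w0 w1 ->]]|[al [be [ga [h1 h2 h3 h4 ->]]]]].
  exists (w 0%N), (w 1%N), (w 2%N).
  by rewrite !big_ord_recl !big_ord0 /= !addr0 !addrA in w1 *; split.
exists (fun n => match n with 0%N => al | 1%N => be | _ => ga end).
by rewrite !big_ord_recl !big_ord0 /= !addr0 !addrA; split=> // -[|[]].
Qed.

Lemma hull3_segment a b c x z (h : R) : 0 <= h <= 1 ->
  hull [:: a; b; c] x -> hull [:: a; b; c] z ->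
  hull [:: a; b; c] (x + h *: (z - x)).
Proof.
move=> /andP[h0 h1] /hull3P[al [be [ga [a0 b0 g0 s1 ->]]]].
move=> /hull3P[al' [be' [ga' [a0' b0' g0' s1' ->]]]]; apply/hull3P.
exists ((1 - h) * al + h * al'), ((1 - h) * be + h * be'), ((1 - h) * ga + h * ga').
have h1' : 0 <= 1 - h by rewrite subr_ge0.
split; rewrite ?addr_ge0 ?mulr_ge0 //.
  have -> : al = 1 - be - ga by lra.
  have -> : al' = 1 - be' - ga' by lra.
  ring.
by apply/rowP => i; rewrite !mxE; ring.
Qed.

Lemma polar_affine p y z : cubic p -> affine_fun (fun x => polar (peval p) x y z).
Proof. by move=> hp al be ga x1 x2 x3 s1; exact: polar_aff. Qed.

Lemma peval_segment p x z (e : R) : cubic p ->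
  peval p (x + e *: (z - x)) =
  (1 - e) ^+ 3 * polar (peval p) x x x + 3 * (1 - e) ^+ 2 * e * polar (peval p) x x z
  + 3 * (1 - e) * e ^+ 2 * polar (peval p) x z z + e ^+ 3 * polar (peval p) z z z.
Proof.
move=> hp; have [_ a1 a2 a3 <-] := is_blossom_polar hp.
have -> : x + e *: (z - x) = (1 - e) *: x + e *: z.
  by apply/rowP => i; rewrite !mxE; ring.
rewrite a1 !a2 !a3 (polarC _ z x) [polar _ z z x]polarAC !(polarC _ z x).
rewrite [polar _ x z x]polarAC.
ring.
Qed.

(* On a convex piece, differentiating along segments issued from x shows that
   the blossom at (x, x, z) only depends on f x and on the gradient at x. *)
Lemma C1_polar (Om : set (plane R)) (f : plane R -> R) (G : plane R -> plane R)
    p a b c x :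
  (forall e : R, 0 < e -> \forall y \near within Om (nbhs x),
        `|f y - f x - \sum_(l < 2) G x 0 l * (y - x) 0 l| <= e * `|y - x|) ->
  (hull [:: a; b; c] `<=` Om)%classic -> is_piece f (hull [:: a; b; c]) p ->
  affine_span a b c -> hull [:: a; b; c] x ->
  forall z, polar (peval p) x x z =
    f x + 3^-1 * \sum_(l < 2) G x 0 l * (z - x) 0 l.
Proof.
move=> dif sOm [hp fp] sp hx.
have key z : hull [:: a; b; c] z ->
    polar (peval p) x x z = f x + 3^-1 * \sum_(l < 2) G x 0 l * (z - x) 0 l.
  move=> hz; have [N0|N0] := eqVneq z x.
    rewrite N0 polar_diag fp // big1 ?mulr0 ?addr0 // => l _.
    by rewrite subrr mxE mulr0.
  have {}N0 : 0 < `|z - x| by rewrite normr_gt0 subr_eq0.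
  set g := \sum_(l < 2) _.
  (* [A] compares two derivatives at [x] in the direction [z - x]: that of the polynomial, $3(b_1 -
     b_0)$ in Bernstein form, and that given by the gradient. [B] and [C] below are the coefficients
     of $h^2$ and $h^3$ along the segment. *)
  pose A := 3 * (polar (peval p) x x z - f x) - g.
  suff : A == 0 by rewrite /A => /eqP hA; apply: (mulfI (x := 3)) => //; lra.
  pose b0 := polar (peval p) x x x; pose b1 := polar (peval p) x x z.
  pose b2 := polar (peval p) x z z; pose b3 := polar (peval p) z z z.
  pose B := 3 * (b0 - 2 * b1 + b2); pose C := - b0 + 3 * b1 - 3 * b2 + b3.
  apply/negPn/negP => A0.
  have {}A0 : 0 < `|A| by rewrite normr_gt0.
  (* With this tolerance $|A + h(B + hC)|$ is at most $|A|/2$. The choice of [h] bounds $|h(B +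
     hC)|$ by $|A|/4$, and together these contradict $A \neq 0$. *)
  have e0 : 0 < `|A| / (2 * `|z - x|) by rewrite divr_gt0 // mulr_gt0.
  have := dif _ e0; rewrite near_withinE => /nbhs_normP[d /= d0 hd].
  pose M := `|B| + `|C| + 1.
  have M0 : 0 < M by rewrite ltr_wpDl.
  (* The three bounds keep the point in the triangle, keep it in the ball of radius [d], and make
     the higher-order terms at most $|A|/4$. *)
  pose h := Num.min (Num.min 1 (d / (2 * `|z - x|))) (`|A| / (4 * M)).
  have h0 : 0 < h by rewrite !lt_min ltr01 !divr_gt0 ?mulr_gt0.
  have h1 : h <= 1 by rewrite !ge_min lexx.
  have hd1 : h * (2 * `|z - x|) <= d.
    by rewrite -ler_pdivlMr ?mulr_gt0 // !ge_min lexx orbT.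
  have hA1 : h * (4 * M) <= `|A|.
    by rewrite -ler_pdivlMr ?mulr_gt0 // !ge_min lexx !orbT.
  pose y := x + h *: (z - x).
  have hy : hull [:: a; b; c] y by apply: hull3_segment => //; rewrite ltW.
  have := hd y; rewrite /ball_ /=.
  have -> : x - y = - (h *: (z - x)) by rewrite /y opprD addrA subrr add0r.
  have -> : y - x = h *: (z - x) by rewrite /y addrC addKr.
  rewrite normrN normrZ gtr0_norm // => hd'.
  have hN : h * `|z - x| < d by have := hd1; have := mulr_gt0 h0 N0; lra.
  move: {hd'} (hd' hN (sOm _ hy)).
  have -> : \sum_(l < 2) G x 0 l * (h *: (z - x)) 0 l = h * g.
    by rewrite /g !sum2 !mxE; ring.
  have fx : f x = b0 by rewrite fp // /b0 polar_diag.
  rewrite fx fp // /y peval_segment // -/b0 -/b1 -/b2 -/b3.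
  have -> : (1 - h) ^+ 3 * b0 + 3 * (1 - h) ^+ 2 * h * b1
      + 3 * (1 - h) * h ^+ 2 * b2 + h ^+ 3 * b3 - b0 - h * g
      = h * (A + h * (B + h * C)).
    by rewrite /A fx -/b1 /B /C; ring.
  have -> : `|A| / (2 * `|z - x|) * (h * `|z - x|) = h * (`|A| / 2).
    by field; rewrite gt_eqF.
  rewrite normrM gtr0_norm // ler_pM2l // => le1.
  have le2 : `|h * (B + h * C)| <= h * M.
    rewrite normrM gtr0_norm // ler_pM2l // (le_trans (ler_normD _ _)) //.
    rewrite /M -addrA lerD2l normrM gtr0_norm //.
    by rewrite (le_trans (ler_piMl _ h1)) // lerDl.
  have le3 : `|A| <= `|A + h * (B + h * C)| + `|h * (B + h * C)|.
    by rewrite -{1}(addrK (h * (B + h * C)) A) ler_normB.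
  by move: hA1 A0 le1 le2 le3; lra.
(* Both sides are affine in [z], so the equality on the triangle extends to the plane from its
   vertices. *)
apply: affine_fun_eq sp _ _ _.
- by move=> al be ga u v w s1 /=; rewrite !(polarAC _ x x) !(polarC _ x);
    exact: polar_affine.
- move=> al be ga u v w s1 /=; rewrite !sum2 !mxE.
  by have -> : al = 1 - be - ga; [lra | ring].
- by apply: key; apply/hull3P; exists 1, 0, 0; split;
    rewrite ?ler01 ?scale0r ?scale1r ?addr0.
- by apply: key; apply/hull3P; exists 0, 1, 0; split;
    rewrite ?ler01 ?scale0r ?scale1r ?addr0 ?add0r.
- by apply: key; apply/hull3P; exists 0, 0, 1; split;
    rewrite ?ler01 ?scale0r ?scale1r ?addr0 ?add0r.
Qed.

End Geometry.

(** * Symmetric multiaffine forms and the algebra of the smoothness conditions *)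

Section Affine.
Variable R : realType.
Implicit Types (a b c x y z u w : plane R) (f : plane R -> R)
  (Q : plane R -> plane R -> R) (d : plane R -> plane R -> plane R -> R).

Lemma affine_span_rot a b c : affine_span a b c -> affine_span b c a.
Proof.
move=> sp z; have [al [be [ga [s1 ->]]]] := sp z; exists be, ga, al.
by split; [rewrite -s1; ring | rewrite [RHS]addrC addrA].
Qed.

Lemma affine_span_swap a b c : affine_span a b c -> affine_span b a c.
Proof.
move=> sp z; have [al [be [ga [s1 ->]]]] := sp z; exists be, al, ga.
by split; [rewrite -s1; ring | rewrite [be *: b + _]addrC].
Qed.

Lemma affine_span_change a b c (al be ga : R) : al + be + ga = 1 -> ga != 0 ->
  affine_span a b c -> affine_span a b (al *: a + be *: b + ga *: c).
Proof.
move=> s1 g0 sp z; have [al' [be' [ga' [s1' ->]]]] := sp z.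
exists (al' - ga' / ga * al), (be' - ga' / ga * be), (ga' / ga); split.
  have -> : al = 1 - be - ga by lra.
  have -> : al' = 1 - be' - ga' by lra.
  by field.
by apply/rowP => i; rewrite !mxE; field.
Qed.

Lemma affine_fun0 f a b c : affine_fun f -> affine_span a b c ->
  f a = 0 -> f b = 0 -> f c = 0 -> forall z, f z = 0.
Proof.
by move=> af sp; apply: affine_fun_eq sp => // al be ga x y z _; rewrite !mulr0 !addr0.
Qed.

Lemma affine_fun2 f (al be : R) x y : affine_fun f -> al + be = 1 ->
  f (al *: x + be *: y) = al * f x + be * f y.
Proof.
move=> af s1; have := af al be 0 x y 0; rewrite addr0 scale0r mul0r !addr0.
by apply.
Qed.

(** The polar forms of quadratics; [triaffine] is the analogue for cubics and will be applied to
    differences of blossoms. Symmetry transfers affinity from the first argument to the others. *)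
Definition biaffine Q :=
  (forall x y, Q x y = Q y x) /\ forall y, affine_fun (fun x => Q x y).

Definition triaffine d := [/\ forall x y z, d x y z = d y x z,
  forall x y z, d x y z = d x z y & forall y z, affine_fun (fun x => d x y z)].

Lemma biaffine_slice d u : triaffine d -> biaffine (d u).
Proof.
move=> [sxy syz af]; split=> // y al be ga x1 x2 x3 s1 /=.
by rewrite !(sxy u); exact: af.
Qed.

(** A symmetric biaffine form has six coefficients on [a], [b], [c]: five involve [a] or [b], and
    the sixth is [Q c c]. *)
Lemma biaffine0 Q a b c : biaffine Q -> affine_span a b c ->
  (forall z, Q a z = 0) -> (forall z, Q b z = 0) -> Q c c = 0 ->
  forall x y, Q x y = 0.
Proof.
move=> [sQ aQ] sp Qa Qb Qcc x y; apply: (affine_fun0 (aQ y) sp) => //.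
by rewrite sQ; apply: (affine_fun0 (aQ c) sp).
Qed.

(** The value at the midpoint is a quarter of $d(x,x,z) + 2d(x,y,z) + d(y,y,z)$. This passes from
    agreement at the points of a segment to agreement at pairs of them. *)
Lemma triaffine_polarize d x y z : triaffine d ->
  d x x z = 0 -> d y y z = 0 ->
  d (2^-1 *: x + 2^-1 *: y) (2^-1 *: x + 2^-1 *: y) z = 0 -> d x y z = 0.
Proof.
move=> [sxy _ af] dxx dyy; have h2 : 2^-1 + 2^-1 = 1 :> R by field.
set m := _ + _; have dm w : d m w z = 2^-1 * d x w z + 2^-1 * d y w z.
  exact: (affine_fun2 _ _ (af w z)).
by rewrite dm (sxy x) (sxy y) !dm dxx dyy (sxy y x); lra.
Qed.

Lemma triaffine_line0 d m c u : triaffine d ->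
  (forall y z, d m y z = 0) -> (forall y z, d c y z = 0) ->
  hull [:: m; c] u -> forall y z, d u y z = 0.
Proof.
move=> [_ _ af] dm dc /hull2P[al [be [_ _ s1 ->]]] y z.
by rewrite (affine_fun2 _ _ (af y z)) // dm dc !mulr0 addr0.
Qed.

(** Here [d] is the jump across the segment [[m, c]]. For [u] among [m] and [c], the $C^1$
    conditions leave only [d u a a]. As [b] lies on the line [a m], [d a b u] equals [s * d u a a],
    so one scalar equation for each [u] is enough. *)
Lemma C2_across_cut d a b m c (s : R) : triaffine d -> affine_span a m c ->
  s != 0 -> b = (1 - s) *: m + s *: a ->
  (forall z, d m m z = 0) -> (forall z, d m c z = 0) -> (forall z, d c c z = 0) ->
  d a b c = 0 -> d a b m = 0 ->
  (forall y z, d m y z = 0) /\ (forall y z, d c y z = 0).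
Proof.
move=> td sp s0 bE dmm dmc dcc dabc dabm; have [sxy syz af] := td.
have key u : (forall z, d u m z = 0) -> (forall z, d u c z = 0) ->
    d a b u = 0 -> forall y z, d u y z = 0.
  move=> dum duc; rewrite bE sxy (affine_fun2 _ _ (af a u)) ?subrK //
    [d m a u]syz [d m u a]sxy dum mulr0 add0r.
  move=> /eqP; rewrite mulf_eq0 (negPf s0) /= syz sxy => /eqP duaa.
  exact: (biaffine0 (biaffine_slice _ td) (affine_span_rot sp)).
split; apply: key => // z; by rewrite sxy.
Qed.

(** [X] and [Y] stand for the jumps across [[o, a]] and [[o, b]]; the jump across [[o, c]] is their
    difference, which vanishes once an argument is [c]. Expanding [X o b = 0] over the vertices
    leaves [be * X b b], because [X b c = Y c b = 0]. *)
Lemma clough_tocher_quadratic (X Y : plane R -> plane R -> R) a b c o (al be ga : R) :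
  biaffine X -> biaffine Y -> affine_span a b c ->
  al + be + ga = 1 -> be != 0 -> ga != 0 -> o = al *: a + be *: b + ga *: c ->
  (forall z, X o z = 0) -> (forall z, X a z = 0) -> (forall z, Y b z = 0) ->
  (forall z, X c z = Y c z) -> forall y z, X y z = 0.
Proof.
move=> bX bY sp s1 be0 ga0 oE Xo Xa Yb XYc; have [sX aX] := bX.
have Xbb : X b b = 0.
  have := Xo b; rewrite oE aX // Xa XYc (bY.1 c) Yb !mulr0 add0r addr0.
  by move=> /eqP; rewrite mulf_eq0 (negPf be0) => /eqP.
apply: (biaffine0 (a := a) (b := o) (c := b)) => //; rewrite oE.
apply/affine_span_swap/affine_span_rot/affine_span_rot.
exact: affine_span_change.
Qed.

(** Expanding [d a o b = 0] over [a], [b], [c] leaves [be * d a b b], since [d a a b] and [d a b c]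
    vanish. The slice [d a] is then zero on the triangle [a], [o], [b]. *)
Lemma C2_across_spoke d a b c o (al be ga : R) :
  triaffine d -> affine_span a b c -> al + be + ga = 1 -> be != 0 -> ga != 0 ->
  o = al *: a + be *: b + ga *: c ->
  (forall z, d a a z = 0) -> (forall z, d a o z = 0) -> d a b c = 0 ->
  forall y z, d a y z = 0.
Proof.
move=> td sp s1 be0 ga0 oE daa dao dabc; have [sxy syz af] := td.
have [sX aX] := biaffine_slice a td.
have dabb : d a b b = 0.
  have := dao b; rewrite oE aX // daa syz dabc !mulr0 add0r addr0.
  by move=> /eqP; rewrite mulf_eq0 (negPf be0) => /eqP.
apply: (biaffine0 (a := a) (b := o) (c := b)) => //; rewrite oE.
apply/affine_span_swap/affine_span_rot/affine_span_rot.
exact: affine_span_change.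
Qed.

Lemma collinearE a b c : collinear a b c =
  ((b - a) 0 0 * (c - a) 0 1 - (b - a) 0 1 * (c - a) 0 0 == 0).
Proof.
rewrite /collinear (expand_det_row _ 0) sum2 /cofactor !det_mx11 !mxE /=.
have -> : lift 0 0 = 1 :> 'I_2 by exact: val_inj.
have -> : lift 1 0 = 0 :> 'I_2 by exact: val_inj.
by congr (_ == _); rewrite expr0 expr1; ring.
Qed.

Lemma noncollinear_span a b c : ~~ collinear a b c -> affine_span a b c.
Proof.
rewrite collinearE; set D := (X in X == 0) => D0 z.
(* Cramer's rule in the basis [b - a], [c - a], of determinant [D]. *)
pose be := ((z - a) 0 0 * (c - a) 0 1 - (z - a) 0 1 * (c - a) 0 0) / D.
pose ga := ((b - a) 0 0 * (z - a) 0 1 - (b - a) 0 1 * (z - a) 0 0) / D.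
exists (1 - be - ga), be, ga; split; first by ring.
apply: row2P; rewrite !mxE /be /ga !mxE; move: D0; rewrite /D !mxE => D0; by field.
Qed.

Lemma noncollinear_free a b c (al be ga al' be' ga' : R) : ~~ collinear a b c ->
  al + be + ga = 1 -> al' + be' + ga' = 1 ->
  al *: a + be *: b + ga *: c = al' *: a + be' *: b + ga' *: c ->
  [/\ al = al', be = be' & ga = ga'].
Proof.
rewrite collinearE; set D := (X in X == 0) => D0 s1 s1'.
have {s1} -> : al = 1 - be - ga by lra.
have {s1'} -> : al' = 1 - be' - ga' by lra.
move=> /rowP e.
have ek k : be * (b - a) 0 k + ga * (c - a) 0 k = be' * (b - a) 0 k + ga' * (c - a) 0 k.
  have := e k; rewrite !mxE => ek; apply: (addIr (a 0 k)).
  transitivity ((1 - be - ga) * a 0 k + be * b 0 k + ga * c 0 k); first by ring.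
  by rewrite ek; ring.
have hb : be = be'.
  apply: (mulfI D0); rewrite /D.
  transitivity ((be * (b - a) 0 0 + ga * (c - a) 0 0) * (c - a) 0 1
    - (be * (b - a) 0 1 + ga * (c - a) 0 1) * (c - a) 0 0); first by ring.
  by rewrite !ek; ring.
have hc : ga = ga'.
  apply: (mulfI D0); rewrite /D.
  transitivity ((be * (b - a) 0 1 + ga * (c - a) 0 1) * (b - a) 0 0
    - (be * (b - a) 0 0 + ga * (c - a) 0 0) * (b - a) 0 1); first by ring.
  by rewrite !ek; ring.
by rewrite hb hc.
Qed.

End Affine.

(** * Combinatorics of the mesh *)

Section Hulls.
Variables (R : realType) (V : finType).
Implicit Types (A : {set V}) (i j k : V) (p : V -> plane R).

(** Weights in [hull] are indexed by positions in an enumeration; this reindexes them by vertices.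
    [F] receives both the position and the point, so that it serves for the sum of the weights and
    for the weighted sum of the points. *)
Lemma sum_image (T : nmodType) A p (F : nat -> plane R -> T) i0 :
  \sum_(l < size [seq p i | i in A]) F l [seq p i | i in A]`_l =
  \sum_(i in A) F (index i (enum A)) (p i).
Proof.
rewrite -(big_enum _ _ A (fun i => F (index i (enum A)) (p i))).
rewrite (big_nth i0) big_mkord size_map; apply: eq_bigr => l _.
by rewrite (nth_map i0) // index_uniq // enum_uniq.
Qed.

Lemma sum_set2 (T : nmodType) i j (F : V -> T) : i != j ->
  \sum_(l in [set i; j]) F l = F i + F j.
Proof. by move=> nij; rewrite big_setU1 ?finset.inE // big_set1. Qed.

Lemma sum_set3 (T : nmodType) i j k (F : V -> T) : i != j -> i != k -> j != k ->
  \sum_(l in [set i; j; k]) F l = F i + F j + F k.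
Proof.
move=> nij nik njk; have kn : k \notin [set i; j].
  by rewrite !finset.inE negb_or ![k == _]eq_sym nik njk.
rewrite finset.setUC big_setU1 // sum_set2 //. by rewrite [LHS]addrC.
Qed.

Lemma hull_set2 i j p x : i != j -> hull [seq p l | l in [set i; j]] x ->
  exists al be : R, [/\ 0 <= al, 0 <= be, al + be = 1 & x = al *: p i + be *: p j].
Proof.
move=> nij [w [w0 w1 ->]]; pose r := enum [set i; j].
exists (w (index i r)), (w (index j r)).
move: w1; rewrite (sum_image _ _ (fun l _ => w l) i).
rewrite (sum_image _ _ (fun l x => w l *: x) i).
by rewrite !sum_set2.
Qed.

Lemma open_hull_set2 i j p x : i != j -> open_hull [seq p l | l in [set i; j]] x ->
  exists s : R, [/\ 0 < s, 0 < 1 - s & x = (1 - s) *: p i + s *: p j].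
Proof.
move=> nij [w [w0 w1 ->]]; exists (w (index j (enum [set i; j]))).
move: w1; rewrite (sum_image _ _ (fun l _ => w l) i).
rewrite (sum_image _ _ (fun l x => w l *: x) i).
by rewrite !sum_set2 // => <-; rewrite addrK.
Qed.

Lemma open_hull_set3 i j k p x : i != j -> i != k -> j != k ->
  open_hull [seq p l | l in [set i; j; k]] x ->
  exists al be ga : R, [/\ 0 < al, 0 < be, 0 < ga, al + be + ga = 1
    & x = al *: p i + be *: p j + ga *: p k].
Proof.
move=> nij nik njk [w [w0 w1 ->]]; pose r := enum [set i; j; k].
exists (w (index i r)), (w (index j r)), (w (index k r)).
move: w1; rewrite (sum_image _ _ (fun l _ => w l) i).
rewrite (sum_image _ _ (fun l x => w l *: x) i).
by rewrite !sum_set3.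
Qed.

Lemma hull_set3 i j k p (al be ga : R) : i != j -> i != k -> j != k ->
  0 <= al -> 0 <= be -> 0 <= ga -> al + be + ga = 1 ->
  hull [seq p l | l in [set i; j; k]] (al *: p i + be *: p j + ga *: p k).
Proof.
move=> nij nik njk a0 b0 g0 s1; pose r := enum [set i; j; k].
pose f l := if l == i then al else if l == j then be else ga.
(* Past the end of the enumeration the default [i] yields the weight [al], so nonnegativity holds at
   every position. *)
exists (fun l => f (nth i r l)).
rewrite (sum_image _ _ (fun l _ => f (nth i r l)) i).
rewrite (sum_image _ _ (fun l x => f (nth i r l) *: x) i).
have nk l : l \in [set i; j; k] -> nth i r (index l r) = l.
  by move=> hl; rewrite nth_index // mem_enum.
rewrite !sum_set3 // !nk; try by rewrite !finset.inE eqxx ?orbT.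
rewrite /f !eqxx ![_ == i]eq_sym (negPf nij) (negPf nik) [k == j]eq_sym (negPf njk).
by split=> // l; case: ifP => // _; case: ifP.
Qed.

End Hulls.

Section Triples.
Variable V : finType.
Implicit Types (i j k : V) (t e : {set V}).

Lemma set3AC i j k : [set i; j; k] = [set i; k; j].
Proof. exact: finset.setUAC. Qed.

Lemma set3C i j k : [set i; j; k] = [set j; i; k].
Proof. by rewrite (finset.setUC [set i]). Qed.

Lemma card3_neq i j k : #|[set i; j; k]| = 3%N -> [/\ i != j, i != k & j != k].
Proof.
move=> c3; have nij (a b c : V) : #|[set a; b; c]| = 3%N -> a != b.
  apply: contra_eq_neq => ->; rewrite finset.setUid.
  by rewrite neq_ltn cards2 ltnS; case: eqP.
split; first exact: (nij i j k).
  by apply: (nij i k j); rewrite set3AC.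
by apply: (nij j k i); rewrite set3AC set3C.
Qed.

Lemma card3_set2 t i j : #|t| = 3%N -> i \in t -> j \in t -> i != j ->
  exists k, t = [set i; j; k].
Proof.
move=> c3 it jt nij; have : #|t :\: [set i; j]| = 1%N.
  rewrite cardsD (finset.setIidPr _) ?c3 ?cards2 ?nij //.
  by apply/fintype.subsetP => x /set2P[] ->.
move=> /eqP/cards1P[k hk]; exists k.
rewrite -hk; apply/finset.setP => x; rewrite !finset.inE.
case: (x =P i) => [->|_]; first by rewrite it.
by case: (x =P j) => [->|_]; rewrite ?jt.
Qed.

Lemma card3_set1 t i : #|t| = 3%N -> i \in t -> exists j k, t = [set i; j; k].
Proof.
move=> c3 it; have : (0 < #|t :\ i|)%N.
  by have := cardsD1 i t; rewrite c3 it add1n => -[<-].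
move=> /card_gt0P[j]; rewrite !finset.inE => /andP[nji jt].
by rewrite eq_sym in nji; have [k ->] := card3_set2 c3 it jt nji; exists j, k.
Qed.

Lemma card2_set e : #|e| = 2%N -> exists i j, e = [set i; j] /\ i != j.
Proof. by move=> /eqP/cards2P[i [j [nij ->]]]; exists i, j. Qed.

Lemma set3_inj i j k j' k' : #|[set i; j; k]| = 3%N ->
  [set i; j'; k'] = [set i; j; k] -> (j' = j /\ k' = k) \/ (j' = k /\ k' = j).
Proof.
move=> c3 h; have := c3; rewrite -h => /card3_neq[nij nik njk].
have: j' \in [set i; j; k] by rewrite -h !finset.inE eqxx orbT.
have: k' \in [set i; j; k] by rewrite -h !finset.inE eqxx orbT.
rewrite !finset.inE ![_ == i]eq_sym (negPf nij) (negPf nik) /=.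
by move=> /orP[]/eqP ek /orP[]/eqP ej; subst j' k'; rewrite ?eqxx // in njk *; auto.
Qed.

End Triples.

(** * Barycentric description of the Powell-Sabin cells and of adjacent triangles *)

Section Refinement.
Variables (R : realType) (V : finType) (D : mesh R V) (P : ps_points R V).
Hypotheses (hD : is_triangulation D) (hP : is_PS_refinement D P).
Implicit Types (i j k : V) (e t : {set V}).

Local Notation v := (pos D).
Local Notation vt := (split_pt P).
Local Notation ve := (edge_pt P).

Lemma tri_neq i j k : [set i; j; k] \in tris D -> [/\ i != j, i != k & j != k].
Proof. by move=> /(card_tri hD)/card3_neq. Qed.

Lemma tri_edge i j k : [set i; j; k] \in tris D -> [set i; j] \in edges D.
Proof.
move=> ht; have [nij _ _] := tri_neq ht.
apply: (tri_sides hD ht); last by rewrite cards2 nij.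
exact: finset.subsetUl.
Qed.

Lemma tri_span i j k : [set i; j; k] \in tris D -> affine_span (v i) (v j) (v k).
Proof. by move=> /(tri_nondegenerate hD)/noncollinear_span. Qed.

Lemma split_coords i j k : [set i; j; k] \in tris D ->
  exists al be ga : R, [/\ 0 < al, 0 < be, 0 < ga, al + be + ga = 1
    & vt [set i; j; k] = al *: v i + be *: v j + ga *: v k].
Proof.
move=> ht; have [nij nik njk] := tri_neq ht.
exact: open_hull_set3 (split_inside hP ht).
Qed.

Lemma cut_coords i j k : [set i; j; k] \in tris D ->
  exists s : R, [/\ 0 < s, 0 < 1 - s & ve [set i; j] = (1 - s) *: v i + s *: v j].
Proof.
move=> ht; have [nij _ _] := tri_neq ht.
exact: open_hull_set2 (cut_inside hP (tri_edge ht)).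
Qed.

(** Starting from the vertices, [v k] is exchanged for the split point and then [v j] for the cut
    point; both exchanges are licit because the weight of the replaced vertex is positive. *)
Lemma cell_span i j k : [set i; j; k] \in tris D ->
  affine_span (v i) (ve [set i; j]) (vt [set i; j; k]).
Proof.
move=> ht; have [al [be [ga [_ _ g0 s1 ->]]]] := split_coords ht.
have [s [s0 _ ->]] := cut_coords ht.
have sp := affine_span_change s1 (lt0r_neq0 g0) (tri_span ht).
set o := _ + _ + _ in sp *; have s1' : 1 - s + 0 + s = 1 by lra.
have := affine_span_change s1' (lt0r_neq0 s0)
  (affine_span_swap (affine_span_rot (affine_span_rot sp))).
by rewrite scale0r addr0 => /affine_span_swap/affine_span_rot.
Qed.

(** The sign conditions that tell the six cells of a triangle apart: [0 < al] excludes the side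
    opposite to [v i], and the last one says that the cell meets the side from [v i] to [v k] only
    at [v i]. *)
Lemma ps_cell_coords i j k x : [set i; j; k] \in tris D -> ps_cell D P i j k x ->
  exists al be ga : R,
    [/\ al + be + ga = 1, x = al *: v i + be *: v j + ga *: v k,
      0 < al, 0 <= be /\ 0 <= ga & be = 0 -> ga = 0].
Proof.
move=> ht /hull3P[w0 [w1 [w2 [h0 h1 h2 w012 ->]]]].
have [al [be [ga [a0 b0 g0 s1 ->]]]] := split_coords ht.
have [s [s0 s1' ->]] := cut_coords ht.
exists (w0 + w1 * (1 - s) + w2 * al), (w1 * s + w2 * be), (w2 * ga).
have m1 := mulr_ge0 h1 (ltW s0); have m2 := mulr_ge0 h1 (ltW s1').
have m3 := mulr_ge0 h2 (ltW a0); have m4 := mulr_ge0 h2 (ltW b0).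
have m5 := mulr_ge0 h2 (ltW g0).
split.
- have -> : al = 1 - be - ga by lra.
  have -> : w0 = 1 - w1 - w2 by lra.
  ring.
- by apply/rowP => l; rewrite !mxE; ring.
- rewrite lt_neqAle !addr_ge0 // andbT eq_sym; apply/eqP => e0.
  have e1 : w0 = 0 by lra.
  have /eqP : w1 * (1 - s) = 0 by lra.
  rewrite mulf_eq0 (gt_eqF s1') orbF => /eqP e2.
  have /eqP : w2 * al = 0 by lra.
  rewrite mulf_eq0 (gt_eqF a0) orbF => /eqP e3.
  by move: w012; rewrite e1 e2 e3; lra.
- by split; lra.
- move=> e0; have /eqP : w2 * be = 0 by lra.
  by rewrite mulf_eq0 (gt_eqF b0) orbF => /eqP ->; rewrite mul0r.
Qed.

Lemma ps_cell_sub i j k : [set i; j; k] \in tris D ->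
  (ps_cell D P i j k `<=` cell D [set i; j; k])%classic.
Proof.
move=> ht x /(ps_cell_coords ht)[al [be [ga [s1 -> a0 [b0 g0] _]]]].
have [nij nik njk] := tri_neq ht.
by apply: hull_set3 => //; exact: ltW.
Qed.

Lemma ps_cell_Omega i j k : [set i; j; k] \in tris D ->
  (ps_cell D P i j k `<=` Omega D)%classic.
Proof. by move=> ht x /(ps_cell_sub ht); exists [set i; j; k]. Qed.

(** Two distinct triangles meet at most in a vertex or an edge, where some barycentric coordinate is
    zero, whereas those of the split point are all positive. *)
Lemma split_cell t t' : t \in tris D -> t' \in tris D -> cell D t' (vt t) -> t' = t.
Proof.
move=> ht ht' c'; apply/eqP; apply: contraT; rewrite eq_sym => ntt'.
have ct : cell D t (vt t).
  have [i it] : exists i, i \in t by apply/card_gt0P; rewrite (card_tri hD ht).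
  have [j [k tE]] := card3_set1 (card_tri hD ht) it; subst t.
  have [al [be [ga [a0 b0 g0 s1 ->]]]] := split_coords ht.
  by have [nij nik njk] := tri_neq ht; apply: hull_set3 => //; exact: ltW.
have ctt' : (cell D t `&` cell D t')%classic (vt t) by [].
case: (tri_meet hD ht ht' ntt') => [h|[i + h]|[e /andP[eE + ] h]]; rewrite {}h in ctt'.
- by [].
- move=> /finset.setIP[it _]; have [j [k tE]] := card3_set1 (card_tri hD ht) it; subst t.
  have [al [be [ga [a0 b0 g0 s1]]]] := split_coords ht.
  rewrite ctt' => e; have nc := tri_nondegenerate hD ht.
  have [] := @noncollinear_free _ _ _ _ 1 0 0 _ _ _ nc _ s1.
  + by rewrite !addr0.
  + by rewrite !scale0r scale1r !addr0.
  + by move=> _ _ g; rewrite -g ltxx in g0.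
- have /card2_set[i [j [eE' nij]]] := card_edge hD eE.
  move=> /fintype.subsetP se; have st := fintype.subsetP (finset.subsetIl t t').
  have it : i \in t by apply/st/se; rewrite eE' !finset.inE eqxx.
  have jt : j \in t by apply/st/se; rewrite eE' !finset.inE eqxx orbT.
  have [k tE] := card3_set2 (card_tri hD ht) it jt nij; subst t e.
  have [al [be [ga [a0 b0 g0 s1]]]] := split_coords ht.
  have [al' [be' [_ _ s1' ->]]] := hull_set2 nij ctt'.
  move=> e; have nc := tri_nondegenerate hD ht.
  have [] := @noncollinear_free _ _ _ _ al' be' 0 _ _ _ nc _ s1.
  + by rewrite addr0.
  + by rewrite scale0r addr0.
  + by move=> _ _ g; rewrite -g ltxx in g0.
Qed.

(** The split point identifies the triangle, and [v i] identifies the first index of the cell, whose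
    coordinate is positive throughout the cell. *)
Lemma spoke_cells t i s : t \in tris D -> i \in t -> ps_tri D P s ->
  (hull [:: v i; vt t] `<=` s)%classic ->
  exists j k, t = [set i; j; k] /\ s = ps_cell D P i j k.
Proof.
move=> ht it [i' [j' [k' [ht' ->]]]] sub.
have t'E : [set i'; j'; k'] = t.
  apply: (split_cell ht ht'); apply: (ps_cell_sub ht'); apply: sub.
  by apply/hull2P; exists 0, 1; rewrite scale0r scale1r !add0r ler01; split.
suff -> : i = i' by exists j', k'.
have : ps_cell D P i' j' k' (v i).
  by apply/sub/hull2P; exists 1, 0; rewrite scale0r scale1r !addr0 ler01; split.
move=> /(ps_cell_coords ht')[al [be [ga [s1 e a0 _ _]]]].
move: it; rewrite -t'E !finset.inE -orbA => /or3P[/eqP //||]/eqP iE; subst i.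
- have nc := tri_nondegenerate hD ht'.
  have [] := @noncollinear_free _ _ _ _ 0 1 0 _ _ _ nc _ s1.
  + by rewrite addr0 add0r.
  + by rewrite !scale0r scale1r !addr0 add0r.
  + by move=> g; rewrite -g ltxx in a0.
- have nc := tri_nondegenerate hD ht'.
  have [] := @noncollinear_free _ _ _ _ 0 0 1 _ _ _ nc _ s1.
  + by rewrite !add0r.
  + by rewrite !scale0r scale1r !add0r.
  + by move=> g; rewrite -g ltxx in a0.
Qed.

(** The split point identifies the triangle. The cut point has coordinate zero at [v k] and positive
    ones at [v i] and [v j], which the signs of [ps_cell_coords] rule out in the four other
    cells. *)
Lemma cut_cells i j k s : [set i; j; k] \in tris D -> ps_tri D P s ->
  (hull [:: ve [set i; j]; vt [set i; j; k]] `<=` s)%classic ->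
  s = ps_cell D P i j k \/ s = ps_cell D P j i k.
Proof.
move=> ht [i' [j' [k' [ht' ->]]]] sub.
have t'E : [set i'; j'; k'] = [set i; j; k].
  apply: (split_cell ht ht'); apply: (ps_cell_sub ht'); apply: sub.
  by apply/hull2P; exists 0, 1; rewrite scale0r scale1r !add0r ler01; split.
have : ps_cell D P i' j' k' (ve [set i; j]).
  by apply/sub/hull2P; exists 1, 0; rewrite scale0r scale1r !addr0 ler01; split.
move=> /(ps_cell_coords ht')[al [be [ga [s1 e a0 _ bg]]]].
have [s0 [s00 s01 e']] := cut_coords ht; rewrite {}e' in e.
have c3 := card_tri hD ht; have nc := tri_nondegenerate hD ht'.
have : i' \in [set i; j; k] by rewrite -t'E !finset.inE eqxx.
rewrite !finset.inE -orbA => /or3P[]/eqP iE; subst i'.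
- case: (set3_inj c3 t'E) => -[jE kE]; subst j' k'; first by left.
  have [] := @noncollinear_free _ _ _ _ (1 - s0) 0 s0 _ _ _ nc _ s1.
  + by rewrite addr0 subrK.
  + by rewrite scale0r addr0.
  + by move=> _ b g; move: (bg (esym b)) s00; rewrite -g => ->; rewrite ltxx.
- rewrite set3C in c3; rewrite (set3C i) in t'E.
  case: (set3_inj c3 t'E) => -[jE kE]; subst j' k'; first by right.
  have [] := @noncollinear_free _ _ _ _ s0 0 (1 - s0) _ _ _ nc _ s1.
  + by rewrite addr0 subrKC.
  + by rewrite scale0r addr0 addrC.
  + by move=> _ b g; move: (bg (esym b)) s01; rewrite -g => ->; rewrite ltxx.
- have e2 : [set k; j'; k'] = [set k; i; j] by rewrite t'E set3AC set3C set3AC -set3C.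
  have c3' : #|[set k; i; j]| = 3%N by rewrite -e2 t'E.
  case: (set3_inj c3' e2) => -[jE kE]; subst j' k'.
  + have [] := @noncollinear_free _ _ _ _ 0 (1 - s0) s0 _ _ _ nc _ s1.
    * by rewrite add0r subrK.
    * by rewrite scale0r add0r.
    * by move=> g; rewrite -g ltxx in a0.
  + have [] := @noncollinear_free _ _ _ _ 0 s0 (1 - s0) _ _ _ nc _ s1.
    * by rewrite add0r subrKC.
    * by rewrite scale0r add0r addrC.
    * by move=> g; rewrite -g ltxx in a0.
Qed.

Lemma set3_third i j k k' : [set i; j; k] \in tris D ->
  [set i; j; k'] = [set i; j; k] -> k' = k.
Proof.
move=> ht /(set3_inj (card_tri hD ht)) [[]//|[jk]]; have [_ _] := tri_neq ht.
by rewrite jk eqxx.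
Qed.

Lemma boundary_third i j k k' : [set i; j] \in bedges D ->
  [set i; j; k] \in tris D -> [set i; j; k'] \in tris D -> k' = k.
Proof.
move=> /(boundary_edge hD)/eqP/cards1P[t tE] ht ht'; apply: (set3_third ht).
have tt l : [set i; j; l] \in tris D -> [set i; j; l] = t.
  by move=> hl; apply/set1P; rewrite -tE finset.inE hl finset.subsetUl.
by rewrite (tt _ ht) (tt _ ht').
Qed.

Lemma interior_third i j k : [set i; j] \in edges D :\: bedges D ->
  [set i; j; k] \in tris D ->
  exists k', [/\ k' != k, [set i; j; k'] \in tris D
    & forall l, [set i; j; l] \in tris D -> l != k -> l = k'].
Proof.
move=> /(interior_edge hD)/eqP/cards2P[t1 [t2 [n12 tE]]] ht.
have [nij _ _] := tri_neq ht.
have mem t : (t \in [set t1; t2]) = (t \in tris D) && ([set i; j] \subset t).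
  by rewrite -tE finset.inE.
have third t : t \in [set t1; t2] -> exists l, t = [set i; j; l].
  rewrite mem => /andP[tT /fintype.subsetP st]; apply: card3_set2 => //.
  - exact: (card_tri hD).
  - by apply: st; rewrite !finset.inE eqxx.
  - by apply: st; rewrite !finset.inE eqxx orbT.
have hk : [set i; j; k] \in [set t1; t2] by rewrite mem ht finset.subsetUl.
wlog : t1 t2 n12 tE mem third hk / [set i; j; k] = t1.
  move=> W; move/set2P: (hk) => [e|e]; first exact: (W t1 t2).
  by apply: (W t2 t1); rewrite 1?eq_sym // (finset.setUC [set t2]).
move=> e1; subst t1; have [|k' t2E] := third t2; first by rewrite !finset.inE eqxx orbT.
subst t2; exists k'; split.
- by apply: contraNneq n12 => ->.
- have := mem [set i; j; k']; rewrite !finset.inE eqxx orbT => /esym/andP[]//.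
- move=> l hl nlk; have : [set i; j; l] \in [set [set i; j; k]; [set i; j; k']].
    by rewrite mem hl finset.subsetUl.
  move=> /set2P[/(set3_third ht) lk|/set3_third]; first by rewrite lk eqxx in nlk.
  apply; have := mem [set i; j; k']; rewrite !finset.inE eqxx orbT => /esym/andP[]//.
Qed.

Lemma interior_cut i j k k' : [set i; j] \in edges D :\: bedges D ->
  [set i; j; k] \in tris D -> [set i; j; k'] \in tris D -> k' != k ->
  exists al be : R, al + be = 1 /\
    ve [set i; j] = al *: vt [set i; j; k] + be *: vt [set i; j; k'].
Proof.
move=> he ht ht' nk; have ntt : [set i; j; k] != [set i; j; k'].
  by apply: contra nk => /eqP/esym/(set3_third ht) ->.
have := cut_interior hP he ht ht' ntt (finset.subsetUl _ _) (finset.subsetUl _ _).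
move=> h; have : [set ve [set i; j]]%classic (ve [set i; j]) by [].
by rewrite -h => -[/hull2P[al [be [_ _ s1 e]]] _]; exists al, be.
Qed.

Lemma split_neq i j k k' : [set i; j; k] \in tris D -> [set i; j; k'] \in tris D ->
  k' != k -> vt [set i; j; k] != vt [set i; j; k'].
Proof.
move=> ht ht' nk; apply/eqP => e; have [al [be [ga [a0 b0 g0 s1 h]]]] := split_coords ht'.
have [nij nik njk] := tri_neq ht'.
have := split_cell ht ht'; rewrite e h => -/(_ _) h'.
suff /(set3_third ht) kk : [set i; j; k'] = [set i; j; k] by rewrite kk eqxx in nk.
by apply: h'; apply: hull_set3 => //; exact: ltW.
Qed.

End Refinement.

(** * Blossoms of the pieces of a spline *)

Section Pieces.
Variable R : realType.
Implicit Types (p : mpoly 2 R) (a b c x y z : plane R) (f g : plane R -> R).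

(** [polar] evaluates at means, which stay in the triangle, so the blossoms agree when all arguments
    lie there. Affinity then frees the arguments one after the other. *)
Lemma is_piece_polar f a b c p1 p2 : affine_span a b c ->
  is_piece f (hull [:: a; b; c]) p1 -> is_piece f (hull [:: a; b; c]) p2 ->
  forall x y z, polar (peval p1) x y z = polar (peval p2) x y z.
Proof.
move=> sp [h1 e1] [h2 e2].
have mid x y : hull [:: a; b; c] x -> hull [:: a; b; c] y ->
    hull [:: a; b; c] (2^-1 *: (x + y)).
  move=> hx hy; have -> : 2^-1 *: (x + y) = x + 2^-1 *: (y - x).
    by apply/rowP => l; rewrite !mxE; field.
  by apply: hull3_segment => //; lra.
have third x y z : hull [:: a; b; c] x -> hull [:: a; b; c] y -> hull [:: a; b; c] z ->
    hull [:: a; b; c] (3^-1 *: (x + y + z)).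
  move=> hx hy hz.
  have -> : 3^-1 *: (x + y + z) = z + (2 / 3) *: (2^-1 *: (x + y) - z).
    by apply/rowP => l; rewrite !mxE; field.
  by apply: hull3_segment => //; [lra | exact: mid].
have key x y z : hull [:: a; b; c] x -> hull [:: a; b; c] y -> hull [:: a; b; c] z ->
    polar (peval p1) x y z = polar (peval p2) x y z.
  move=> hx hy hz; rewrite /polar -!e1 -?e2 //; try exact: mid; exact: third.
have [ha hb hc] : [/\ hull [:: a; b; c] a, hull [:: a; b; c] b & hull [:: a; b; c] c].
  split; apply/hull3P; [exists 1, 0, 0 | exists 0, 1, 0 | exists 0, 0, 1]; split;
    by rewrite ?ler01 ?scale0r ?scale1r ?addr0 ?add0r.
have k1 y z : hull [:: a; b; c] y -> hull [:: a; b; c] z ->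
    forall x, polar (peval p1) x y z = polar (peval p2) x y z.
  by move=> hy hz; apply: (affine_fun_eq (polar_affine y z h1) (polar_affine y z h2) sp);
    apply: key.
have k2 z : hull [:: a; b; c] z ->
    forall x y, polar (peval p1) x y z = polar (peval p2) x y z.
  move=> hz x y; rewrite ![polar _ x y z]polarC; move: y.
  apply: (affine_fun_eq (polar_affine x z h1) (polar_affine x z h2) sp);
    by rewrite polarC [RHS]polarC k1.
move=> x y z; rewrite ![polar _ x y z]polarAC ![polar _ x z y]polarC; move: z.
apply: (affine_fun_eq (polar_affine x y h1) (polar_affine x y h2) sp);
  by rewrite polarC polarAC [RHS]polarC [RHS]polarAC k2.
Qed.

End Pieces.

Section Splines.
Variables (R : realType) (V : finType) (D : mesh R V) (P : ps_points R V).
Hypotheses (hD : is_triangulation D) (hP : is_PS_refinement D P).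
Implicit Types (i j k : V) (e t : {set V}) (f g h : plane R -> R).

Local Notation v := (pos D).
Local Notation vt := (split_pt P).
Local Notation ve := (edge_pt P).

Definition bl f i j k := polar (peval (piece f (ps_cell D P i j k))).

Lemma blC f i j k x y z : bl f i j k x y z = bl f i j k y x z.
Proof. exact: polarC. Qed.

Lemma blAC f i j k x y z : bl f i j k x y z = bl f i j k x z y.
Proof. exact: polarAC. Qed.

(* The C^1 condition on S is only used through its consequence on blossoms;
   unlike C1_on, that form is manifestly stable under linear combinations. *)
Definition blossom_C1 f :=
  (forall i j k, [set i; j; k] \in tris D ->
    is_piece f (ps_cell D P i j k) (piece f (ps_cell D P i j k))) /\
  (forall i j k i' j' k', [set i; j; k] \in tris D -> [set i'; j'; k'] \in tris D ->
    forall x, ps_cell D P i j k x -> ps_cell D P i' j' k' x ->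
    forall z, bl f i j k x x z = bl f i' j' k' x x z).

(** By [C1_polar], both blossoms are given by the same value and the same gradient of [f] at [x]. *)
Lemma spline_blossom_C1 f : spline D P f -> blossom_C1 f.
Proof.
move=> [[G [_ dif]] pc].
have ispc i j k : [set i; j; k] \in tris D ->
    is_piece f (ps_cell D P i j k) (piece f (ps_cell D P i j k)).
  move=> ht; have [|p hp] := pc (ps_cell D P i j k); first by exists i, j, k.
  exact: (@xgetI _ 0 [set p | is_piece f _ p]%classic p hp).
split=> // i j k i' j' k' ht ht' x hx hx' z.
have xO := ps_cell_Omega hD hP ht hx.
have polE a b c (hc : [set a; b; c] \in tris D) (hxc : ps_cell D P a b c x) :=
  C1_polar (dif x xO) (ps_cell_Omega hD hP hc) (ispc _ _ _ hc) (cell_span hD hP hc) hxc.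
by rewrite /bl !polE.
Qed.

Lemma cubicZD (c : R) (p1 p2 : mpoly 2 R) : cubic p1 -> cubic p2 -> cubic (c *: p1 + p2).
Proof.
move=> h1 h2; apply: leq_trans (mmeasureD_le _ _ _) _; rewrite geq_max h2 andbT.
exact: leq_trans (mmeasureZ_le _ _ _) h1.
Qed.

Lemma blossom_C1_piece f i j k p : [set i; j; k] \in tris D ->
  is_piece f (ps_cell D P i j k) p ->
  is_piece f (ps_cell D P i j k) (piece f (ps_cell D P i j k)) /\
  forall x y z, bl f i j k x y z = polar (peval p) x y z.
Proof.
move=> ht hp; have hq : is_piece f (ps_cell D P i j k) (piece f (ps_cell D P i j k)).
  exact: (@xgetI _ 0 [set p | is_piece f _ p]%classic p hp).
by split=> //; exact: is_piece_polar (cell_span hD hP ht) hq hp.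
Qed.

(** The combination of the pieces of [f] and [g] is a piece of [h], and the blossom of a piece is
    unique. Equality on [Omega] is enough since it contains every cell. *)
Lemma blossom_C1_lin (c : R) f g h : blossom_C1 f -> blossom_C1 g ->
  (forall x, Omega D x -> h x = c * f x + g x) ->
  blossom_C1 h /\ forall i j k, [set i; j; k] \in tris D ->
    forall x y z, bl h i j k x y z = c * bl f i j k x y z + bl g i j k x y z.
Proof.
move=> [pf jf] [pg jg] hE.
have key i j k : [set i; j; k] \in tris D ->
    is_piece h (ps_cell D P i j k) (piece h (ps_cell D P i j k)) /\
    forall x y z, bl h i j k x y z = c * bl f i j k x y z + bl g i j k x y z.
  move=> ht; have [cf ef] := pf _ _ _ ht; have [cg eg] := pg _ _ _ ht.
  have [|hh hb] := @blossom_C1_piece h i j k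
      (c *: piece f (ps_cell D P i j k) + piece g (ps_cell D P i j k)) ht.
    split=> [|x hx]; first exact: cubicZD.
    by rewrite pevalD pevalZ -ef // -eg // hE //; exact: ps_cell_Omega hx.
  by split=> // x y z; rewrite hb polarD polarZ.
split=> [|i j k ht]; last by have [] := key i j k ht.
split=> [i j k ht|i j k i' j' k' ht ht' x hx hx' z]; first by have [] := key i j k ht.
have [_ ->] := key _ _ _ ht; have [_ ->] := key _ _ _ ht'.
by rewrite (jf _ _ _ _ _ _ ht ht' x hx hx') (jg _ _ _ _ _ _ ht ht' x hx hx').
Qed.

Lemma blossom_C1_0 h : (forall x, Omega D x -> h x = 0) ->
  blossom_C1 h /\ forall i j k, [set i; j; k] \in tris D ->
    forall x y z, bl h i j k x y z = 0.
Proof.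
move=> hE.
have key i j k : [set i; j; k] \in tris D ->
    is_piece h (ps_cell D P i j k) (piece h (ps_cell D P i j k)) /\
    forall x y z, bl h i j k x y z = 0.
  move=> ht; have [|hh hb] := @blossom_C1_piece h i j k 0 ht.
    split=> [|x hx]; first by rewrite /cubic mmeasure0.
    by rewrite peval0 hE //; exact: ps_cell_Omega hx.
  by split=> // x y z; rewrite hb polar0.
split=> [|i j k ht]; last by have [] := key i j k ht.
split=> [i j k ht|i j k i' j' k' ht ht' x hx hx' z]; first by have [] := key i j k ht.
by have [_ ->] := key _ _ _ ht; have [_ ->] := key _ _ _ ht'.
Qed.

Lemma bl_triaffine f i j k i' j' k' : blossom_C1 f ->
  [set i; j; k] \in tris D -> [set i'; j'; k'] \in tris D ->
  triaffine (fun x y z => bl f i j k x y z - bl f i' j' k' x y z).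
Proof.
move=> [pf _] /pf[c1 _] /pf[c2 _]; split.
- by move=> x y z; rewrite /bl !(polarC _ x y).
- by move=> x y z; rewrite /bl !(polarAC _ x y z).
- by move=> y z al be ga x1 x2 x3 s1; rewrite /bl !polar_aff //; ring.
Qed.

(** Both cells are convex, so they share the midpoint of [x] and [y], and polarization applies. *)
Lemma bl_C1 f i j k i' j' k' x y : blossom_C1 f ->
  [set i; j; k] \in tris D -> [set i'; j'; k'] \in tris D ->
  ps_cell D P i j k x -> ps_cell D P i j k y ->
  ps_cell D P i' j' k' x -> ps_cell D P i' j' k' y ->
  forall z, bl f i j k x y z = bl f i' j' k' x y z.
Proof.
move=> hf ht ht' hx hy hx' hy' z; have [_ jf] := hf; apply/eqP; rewrite -subr_eq0.
have td := bl_triaffine hf ht ht'.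
have diag u : ps_cell D P i j k u -> ps_cell D P i' j' k' u ->
    bl f i j k u u z - bl f i' j' k' u u z = 0.
  by move=> hu hu'; rewrite (jf _ _ _ _ _ _ ht ht' u hu hu') subrr.
apply/eqP; apply: (triaffine_polarize td (diag x hx hx') (diag y hy hy')) => /=.
have -> : 2^-1 *: x + 2^-1 *: y = x + 2^-1 *: (y - x).
  by apply/rowP => l; rewrite !mxE; field.
by apply: diag; apply: hull3_segment => //; lra.
Qed.

End Splines.

(** * From the scalar conditions to smoothness of order two *)

Section Smoothness.
Variables (R : realType) (V : finType) (D : mesh R V) (P : ps_points R V).
Hypotheses (hD : is_triangulation D) (hP : is_PS_refinement D P).
Implicit Types (i j k : V) (e t : {set V}) (f : plane R -> R).

Local Notation v := (pos D).
Local Notation vt := (split_pt P).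
Local Notation ve := (edge_pt P).
Local Notation bl := (bl D P).

Lemma ps_cell_vertices i j k :
  [/\ ps_cell D P i j k (v i), ps_cell D P i j k (ve [set i; j])
    & ps_cell D P i j k (vt [set i; j; k])].
Proof.
split; apply/hull3P; [exists 1, 0, 0 | exists 0, 1, 0 | exists 0, 0, 1]; split;
  by rewrite ?ler01 ?scale0r ?scale1r ?addr0 ?add0r.
Qed.

(** The scalar equations to be added to the $C^1$ conditions: two for each segment from a split
    point to a cut point, one for each spoke of a symmetric triangle. *)
Definition reduced_conditions f :=
  [/\ forall i j k, [set i; j; k] \in tris D ->
        bl f i j k (v i) (v j) (vt [set i; j; k]) =
        bl f j i k (v i) (v j) (vt [set i; j; k]),
      forall i j k, [set i; j; k] \in tris D ->
        bl f i j k (v i) (v j) (ve [set i; j]) =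
        bl f j i k (v i) (v j) (ve [set i; j])
    & forall i j k, [set i; j; k] \in sym_tris D P ->
        bl f i j k (v i) (v j) (v k) = bl f i k j (v i) (v j) (v k)].

Variable f : plane R -> R.
Hypotheses (hf : blossom_C1 D P f) (rf : reduced_conditions f).

Lemma across_cut i j k : [set i; j; k] \in tris D ->
  (forall y z, bl f i j k (ve [set i; j]) y z = bl f j i k (ve [set i; j]) y z) /\
  (forall y z, bl f i j k (vt [set i; j; k]) y z = bl f j i k (vt [set i; j; k]) y z).
Proof.
move=> ht; have ht' := ht; rewrite set3C in ht'.
have [r1 r2 _] := rf.
have td := bl_triaffine hf ht ht'.
have [s [s0 s1 mE]] := cut_coords hD hP ht.
have [_ m1 o1] := ps_cell_vertices i j k.
have [_ m2 o2] := ps_cell_vertices j i k.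
rewrite -set3C in o2; rewrite (finset.setUC [set j]) in m2.
(* Solving the definition of the cut point for [v j] puts it on the line through the cut point and
   [v i], with a nonzero coefficient on [v i]. *)
have bE : v j = (1 - (- (1 - s) / s)) *: ve [set i; j] + (- (1 - s) / s) *: v i.
  by rewrite mE; apply/rowP => l; rewrite !mxE; field; rewrite gt_eqF.
have sn0 : - (1 - s) / s != 0.
  by rewrite mulf_neq0 ?invr_eq0 ?oppr_eq0 ?gt_eqF.
have [|||||c1 c2] := C2_across_cut td (cell_span hD hP ht) sn0 bE.
- by move=> z /=; rewrite (bl_C1 hf ht ht') ?subrr.
- by move=> z /=; rewrite (bl_C1 hf ht ht') ?subrr.
- by move=> z /=; rewrite (bl_C1 hf ht ht') ?subrr.
- by rewrite r1 // subrr.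
- by rewrite r2 // subrr.
by split=> y z; apply/eqP; rewrite -subr_eq0; apply/eqP; [exact: c1 | exact: c2].
Qed.

Lemma spoke_C1 i j k x y : [set i; j; k] \in tris D ->
  x \in [:: v i; vt [set i; j; k]] -> y \in [:: v i; vt [set i; j; k]] ->
  forall z, bl f i j k x y z = bl f i k j x y z.
Proof.
move=> ht; have ht' := ht; rewrite set3AC in ht'.
have [a1 _ o1] := ps_cell_vertices i j k.
have [a2 _ o2] := ps_cell_vertices i k j; rewrite -set3AC in o2.
by rewrite !mem_seq2 => /orP[]/eqP -> /orP[]/eqP -> z; apply: (bl_C1 hf ht ht').
Qed.

Lemma at_split_spoke i j k : [set i; j; k] \in tris D ->
  forall y z, bl f i j k (vt [set i; j; k]) y z = bl f i k j (vt [set i; j; k]) y z.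
Proof.
move=> ht y z; set o := vt _.
have oikj : vt [set i; k; j] = o by rewrite set3AC.
have ojik : vt [set j; i; k] = o by rewrite set3C.
have ojki : vt [set j; k; i] = o by rewrite set3AC.
have okij : vt [set k; i; j] = o by rewrite set3C.
have ht1 : [set i; k; j] \in tris D by rewrite set3AC.
have ht2 : [set j; i; k] \in tris D by rewrite set3C.
have ht3 : [set j; k; i] \in tris D by rewrite set3AC.
have ht4 : [set k; i; j] \in tris D by rewrite set3C.
have [al [be [ga [a0 b0 g0 s1 oE]]]] := split_coords hD hP ht.
have memo x : o \in [:: x; o] by rewrite mem_seq2 eqxx orbT.
have memx x : x \in [:: x; o] by rewrite mem_seq2 eqxx.
(* With one argument at [o], the pieces agree across the cut segments, so one quadratic remains for
   each edge. [X] is then the jump across the spoke of [v i] and [Y] the one across the spoke of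
   [v j]. *)
have bX := biaffine_slice o (bl_triaffine hf ht ht1).
have bY := biaffine_slice o (bl_triaffine hf ht ht3).
have cut1 := (across_cut ht).2.
have cut2 := (across_cut ht1).2; have cut3 := (across_cut ht3).2.
rewrite oikj in cut2; rewrite ojki in cut3.
have sp1 := @spoke_C1 i j k o _ ht (memo _); have sp2 := @spoke_C1 j i k o (v j) ht2.
have sp3 := @spoke_C1 k i j o (v k) ht4.
rewrite ojik in sp2; rewrite okij in sp3.
apply/eqP; rewrite -subr_eq0; apply/eqP; move: y z.
apply: (clough_tocher_quadratic bX bY (tri_span hD ht) s1 _ _ oE);
  rewrite ?lt0r_neq0 //.
- by move=> w /=; rewrite sp1 ?subrr.
- by move=> w /=; rewrite sp1 ?subrr.
- by move=> w /=; rewrite cut1 sp2 ?subrr.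
- by move=> w /=; congr (_ - _); rewrite cut2 cut3 sp3.
Qed.

Lemma sym_spoke i j k : [set i; j; k] \in sym_tris D P ->
  forall y z, bl f i j k (v i) y z = bl f i k j (v i) y z.
Proof.
move=> hs; have ht : [set i; j; k] \in tris D by move: hs; rewrite finset.inE => /andP[].
have ht1 : [set i; k; j] \in tris D by rewrite set3AC.
have [al [be [ga [a0 b0 g0 s1 oE]]]] := split_coords hD hP ht.
move=> y z; apply/eqP; rewrite -subr_eq0; apply/eqP; move: y z.
apply: (C2_across_spoke (bl_triaffine hf ht ht1) (tri_span hD ht) s1 _ _ oE);
  rewrite ?lt0r_neq0 //.
- by move=> z /=; rewrite spoke_C1 ?subrr // mem_seq2 eqxx.
- by move=> z /=; rewrite spoke_C1 ?subrr // mem_seq2 eqxx ?orbT.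
- by have [_ _ /(_ _ _ _ hs) ->] := rf; rewrite subrr.
Qed.

Lemma eq_2jet_bl i j k i' j' k' x :
  [set i; j; k] \in tris D -> [set i'; j'; k'] \in tris D ->
  (forall y z, bl f i j k x y z = bl f i' j' k' x y z) ->
  eq_2jet f (ps_cell D P i j k) (ps_cell D P i' j' k') x.
Proof.
move=> ht ht' e; have [pf _] := hf.
have [c1 _] := pf _ _ _ ht; have [c2 _] := pf _ _ _ ht'.
exact: eq_mderivm.
Qed.

Lemma C2_cut t i j : t \in tris D -> i \in t -> j \in t -> i != j ->
  C2_across D P f (hull [:: ve [set i; j]; vt t]).
Proof.
move=> ht it jt nij; have [k tE] := card3_set2 (card_tri hD ht) it jt nij; subst t.
have ht' := ht; rewrite set3C in ht'; have [c1 c2] := across_cut ht.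
have key x : hull [:: ve [set i; j]; vt [set i; j; k]] x ->
    forall y z, bl f i j k x y z = bl f j i k x y z.
  move=> hx y z; apply/eqP; rewrite -subr_eq0; apply/eqP; move: y z.
  by apply: (triaffine_line0 (bl_triaffine hf ht ht') _ _ hx) => y z /=;
    rewrite ?c1 ?c2 subrr.
move=> s s' /(cut_cells hD hP ht) h /(cut_cells hD hP ht) h' /h[]-> /h'[]-> x hx //.
  by apply: eq_2jet_bl => //; exact: key.
by apply: eq_2jet_bl => // y z; rewrite key.
Qed.

Lemma C2_sym_spoke t i : t \in sym_tris D P -> i \in t ->
  C2_across D P f (hull [:: v i; vt t]).
Proof.
move=> hs it; have ht : t \in tris D by move: hs; rewrite finset.inE => /andP[].
move=> s s' /(spoke_cells hD hP ht it) h /(spoke_cells hD hP ht it) h'.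
move=> /h[j [k [tE ->]]] /h'[j' [k' [tE' ->]]] x hx; subst t.
case: (set3_inj (card_tri hD ht) (esym tE')) => -[ej ek]; subst j' k'; first by [].
have ht1 : [set i; k; j] \in tris D by rewrite set3AC.
apply: eq_2jet_bl => // y z; apply/eqP; rewrite -subr_eq0; apply/eqP; move: y z.
apply: (triaffine_line0 (bl_triaffine hf ht ht1) _ _ hx) => y z /=.
  by rewrite sym_spoke ?subrr.
by rewrite at_split_spoke ?subrr.
Qed.

Lemma C2_split t : t \in tris D -> C2_at_split D P f t.
Proof.
move=> ht i j k i' j' k' tE tE'; rewrite -tE in tE' ht *.
have ht' := ht; rewrite -tE' in ht'; apply: eq_2jet_bl => //.
(* Crossing a cut segment swaps the first two indices of a cell and crossing a spoke the last two;
   these swaps connect all six cells. *)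
have swap a b c : [set a; b; c] = [set i; j; k] ->
    (forall y z, bl f a b c (vt [set i; j; k]) y z = bl f b a c (vt [set i; j; k]) y z) /\
    (forall y z, bl f a b c (vt [set i; j; k]) y z = bl f a c b (vt [set i; j; k]) y z).
  move=> e; have he : [set a; b; c] \in tris D by rewrite e.
  by rewrite -e; split; [exact: (across_cut he).2 | exact: at_split_spoke].
have base a b c : [set a; b; c] = [set i; j; k] -> a = i ->
    forall y z, bl f i j k (vt [set i; j; k]) y z = bl f a b c (vt [set i; j; k]) y z.
  move=> e ai; subst a; case: (set3_inj (card_tri hD ht) e) => -[-> ->] // y z.
  by rewrite (swap i j k _).2.
have : i \in [set i'; j'; k'] by rewrite tE' !finset.inE eqxx.
rewrite !finset.inE -orbA => /or3P[]/eqP ei y z; first exact: base.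
  have e1 : [set j'; i'; k'] = [set i; j; k] by rewrite set3C.
  by rewrite (base _ _ _ e1) // (swap _ _ _ e1).1.
have e1 : [set k'; i'; j'] = [set i; j; k] by rewrite set3C set3AC.
have e2 : [set i'; k'; j'] = [set i; j; k] by rewrite set3AC.
by rewrite (base _ _ _ e1) // (swap _ _ _ e1).1 (swap _ _ _ e2).2.
Qed.

End Smoothness.

(** * The reduced space *)

Section Reduced.
Variables (R : realType) (V : finType) (D : mesh R V) (P : ps_points R V).
Hypotheses (hD : is_triangulation D) (hP : is_PS_refinement D P).
Variables (q : V -> 'I_3 -> plane R) (B : dof V -> plane R -> R) (om : {set V} -> V -> R).
Hypotheses (hB : is_dual_basis D P q B) (hom : is_weights D P om).
Implicit Types (i j k : V) (e t : {set V}) (f g h : plane R -> R) (d : dof V).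

Local Notation v := (pos D).
Local Notation vt := (split_pt P).
Local Notation ve := (edge_pt P).
Local Notation bl := (bl D P).

Definition dofT d i j k : R :=
  if d is Dt a b c then ((a == i) && (b == j) && (c == k))%:R else 0.

Definition dofE d i j : R := if d is De a b then ((a == i) && (b == j))%:R else 0.

Lemma ps_blossomE f i j k : blossom_C1 D P f -> [set i; j; k] \in tris D ->
  ps_blossom D P f i j k = bl f i j k.
Proof. by move=> [pf _] /pf[cp _]; exact: blossomE. Qed.

Lemma dual_C1 d : dof_valid D d -> blossom_C1 D P (B d).
Proof. by move=> hd; have [sB _ _] := hB; apply: spline_blossom_C1 => //; exact: sB. Qed.

Lemma dual_T d i j k : dof_valid D d -> [set i; j; k] \in tris D ->
  bl (B d) i j k (v i) (v j) (vt [set i; j; k]) = dofT d i j k.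
Proof.
move=> hd ht; have [_ b1 b0] := hB.
have <- : beta D P q (Dt i j k) (B d) = bl (B d) i j k (v i) (v j) (vt [set i; j; k]).
  by rewrite /= ps_blossomE //; exact: dual_C1.
have [<-|ne] := pselect (Dt i j k = d); first by rewrite b1 //= !eqxx.
rewrite b0 //; case: d {hd} ne => //= a b c ne.
case: eqP => //= ea; case: eqP => //= eb; case: eqP => //= ec.
by case: ne; rewrite ea eb ec.
Qed.

Lemma dual_E d i j k :
  dof_valid D d -> [set i; j] \in bedges D -> [set i; j; k] \in tris D ->
  bl (B d) i j k (v i) (v j) (ve [set i; j]) = dofE d i j.
Proof.
move=> hd he ht; have [_ b1 b0] := hB.
have <- : beta D P q (De i j) (B d) = bl (B d) i j k (v i) (v j) (ve [set i; j]).
  (* The third vertex picked in [beta] is [k], as a boundary edge lies in a single triangle. *)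
  rewrite /=; case: pickP => [k' hk'|/(_ k)]; last by rewrite ht.
  by rewrite (boundary_third hD he ht hk') ps_blossomE //; exact: dual_C1.
have [<-|ne] := pselect (De i j = d); first by rewrite b1 //= !eqxx.
rewrite b0 //; case: d {hd} ne => //= a b ne.
by case: eqP => //= ea; case: eqP => //= eb; case: ne; rewrite ea eb.
Qed.

(* [a e k] is the coefficient of B^e_{ij,k} in f for e = {i, j} (when {i, j, k} is
   symmetric, that of B^t_ijk), and [b e] the coefficient of B^e_ij. *)
Definition has_coefs f (a : {set V} -> V -> R) (b : {set V} -> R) :=
  [/\ blossom_C1 D P f,
      forall i j k k', [set i; j] \in edges D :\: bedges D ->
        [set i; j; k] \in tris D -> [set i; j; k'] \in tris D -> k' != k ->
        bl f i j k (v i) (v j) (vt [set i; j; k]) =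
        (1 - om [set i; j] k) * a [set i; j] k + om [set i; j] k * a [set i; j] k',
      forall i j k, [set i; j] \in bedges D -> [set i; j; k] \in tris D ->
        bl f i j k (v i) (v j) (vt [set i; j; k]) =
        (1 - om [set i; j] k) * a [set i; j] k + om [set i; j] k * b [set i; j]
    & forall i j k, [set i; j] \in bedges D -> [set i; j; k] \in tris D ->
        bl f i j k (v i) (v j) (ve [set i; j]) = b [set i; j]].

Lemma has_coefsD f g a a' b b' : has_coefs f a b -> has_coefs g a' b' ->
  has_coefs (fun x => f x + g x) (fun e k => a e k + a' e k) (fun e => b e + b' e).
Proof.
move=> [cf f1 f2 f3] [cg g1 g2 g3].
have [|ch hE] := blossom_C1_lin hD hP (c := 1) cf cg (h := fun x => f x + g x).
  by move=> x _; rewrite mul1r.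
split=> // [i j k k' he ht ht' nk|i j k he ht|i j k he ht]; rewrite hE //.
- by rewrite (f1 _ _ _ k') // (g1 _ _ _ k') //; ring.
- by rewrite f2 // g2 //; ring.
- by rewrite f3 // g3 //; ring.
Qed.

(** The formulas of [has_coefs] depend on [i] and [j] only through the edge, which gives the first
    two conditions. For the third, the blossom at $(v_i, v_j, v_k)$ is shown to be [a [set i; j] k],
    and the hypothesis on [a] exchanges [j] and [k]. *)
Lemma reduced_conditions_coefs f a b : has_coefs f a b ->
  (forall i j k, [set i; j; k] \in sym_tris D P -> a [set i; j] k = a [set i; k] j) ->
  blossom_C1 D P f /\ reduced_conditions D P f.
Proof.
move=> [cf f1 f2 f3] sa; split=> //.
have r1 i j k : [set i; j; k] \in tris D ->
    bl f i j k (v i) (v j) (vt [set i; j; k]) = bl f j i k (v i) (v j) (vt [set i; j; k]).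
  move=> ht; have ht' := ht; rewrite set3C in ht'.
  rewrite [RHS]blC (set3C i).
  have [he|he] := boolP ([set i; j] \in bedges D).
    have he' := he; rewrite finset.setUC in he'.
    by rewrite (f2 _ _ _ he' ht') -set3C f2 // (finset.setUC [set j]).
  have {}he : [set i; j] \in edges D :\: bedges D.
    by rewrite finset.inE he (tri_edge hD ht).
  have [k' [nk hk' _]] := interior_third hD he ht.
  have he' := he; rewrite finset.setUC in he'.
  have hk'' := hk'; rewrite set3C in hk''.
  rewrite (f1 _ _ _ _ he' ht' hk'' nk) -set3C (f1 _ _ _ _ he ht hk' nk).
  by rewrite (finset.setUC [set j]).
(* [v j] is a combination of [v i] and the cut point, and the $C^1$ condition applies to both since
   they belong to the two cells along the half-edge. *)
have crossing i j k k' : [set i; j; k] \in tris D -> [set i; j; k'] \in tris D ->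
    forall z, bl f i j k (v i) (v j) z = bl f i j k' (v i) (v j) z.
  move=> ht ht' z; have td := bl_triaffine cf ht ht'; have [sxy syz af] := td.
  have [i1 m1 _] := ps_cell_vertices D P i j k.
  have [i2 m2 _] := ps_cell_vertices D P i j k'.
  have [s [s0 s1 mE]] := cut_coords hD hP ht.
  have bE : v j = (1 - s^-1) *: v i + s^-1 *: ve [set i; j].
    by rewrite mE; apply/rowP => l; rewrite !mxE; field; rewrite gt_eqF.
  apply/eqP; rewrite -subr_eq0; apply/eqP.
  rewrite -/((fun x y z => bl f i j k x y z - bl f i j k' x y z) (v i) (v j) z) sxy.
  rewrite bE (affine_fun2 _ _ (af (v i) z)) ?subrK //=.
  rewrite (bl_C1 cf ht ht' i1 i1 i2 i2) (bl_C1 cf ht ht' m1 i1 m2 i2).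
  by rewrite !subrr !mulr0 addr0.
have afb i j k : [set i; j; k] \in tris D ->
    affine_fun (bl f i j k (v i) (v j)).
  move=> ht al be ga x y z s1; have [pf _] := cf; have [cp _] := pf _ _ _ ht.
  by rewrite /bl ![polar _ (v i) (v j) _]polarAC ![polar _ (v i) _ (v j)]polarC polar_aff.
split=> //.
- move=> i j k ht; have ht' := ht; rewrite set3C in ht'.
  have [he|he] := boolP ([set i; j] \in bedges D).
    have he' := he; rewrite finset.setUC in he'.
    rewrite f3 // [RHS]blC (finset.setUC [set i]).
    by rewrite f3.
  have {}he : [set i; j] \in edges D :\: bedges D.
    by rewrite finset.inE he (tri_edge hD ht).
  have [k' [nk hk' _]] := interior_third hD he ht.
  have hk'' := hk'; rewrite set3C in hk''.
  (* The cut point is an affine combination of the two split points, so the first condition in both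
     triangles implies the second one. *)
  have [al [be [s1 mE]]] := interior_cut hD hP he ht hk' nk.
  rewrite mE [RHS]blC (affine_fun2 _ _ (afb _ _ _ ht)) //.
  rewrite (affine_fun2 _ _ (afb _ _ _ ht')) //.
  rewrite r1 // blC; congr (_ + _ * _).
  by rewrite (crossing i j k k') // r1 // blC (crossing j i k k').
- move=> i j k hs.
  have key x y z : [set x; y; z] \in sym_tris D P ->
      bl f x y z (v x) (v y) (v z) = a [set x; y] z.
    move=> {}hs; have ht : [set x; y; z] \in tris D.
      by move: hs; rewrite finset.inE => /andP[].
    have [h1 h2] := hom.
    have wE : wpt D P x y z = v z by rewrite /wpt hs.
    have afx := afb _ _ _ ht.
    have [he|he] := boolP ([set x; y] \in bedges D).
      have [_ oE] := h2 _ _ _ he ht; rewrite wE in oE.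
      have := f2 _ _ _ he ht.
      rewrite {1}oE (affine_fun2 _ _ afx) ?subrK // f3 // => /addIr; apply: mulfI.
      (* After cancelling the term at the cut point, one divides by $1 - \omega$; $\omega = 1$ would
         put the split point on the edge. *)
      apply: contraTneq isT => o1.
      have [al [be [ga [_ _ g0 s1 sE]]]] := split_coords hD hP ht.
      have [s [_ _ mE]] := cut_coords hD hP ht.
      have o1' : om [set x; y] z = 1 by lra.
      rewrite o1 o1' scale0r add0r scale1r mE sE in oE.
      have nc := tri_nondegenerate hD ht.
      have [] := @noncollinear_free _ _ _ _ al be ga (1 - s) s 0 nc s1.
      - by rewrite addr0 subrK.
      - by rewrite scale0r addr0.
      - by move=> _ _ g; rewrite g ltxx in g0.
    have {}he : [set x; y] \in edges D :\: bedges D.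
      by rewrite finset.inE he (tri_edge hD ht).
    have [z' [nz hz' _]] := interior_third hD he ht.
    have nz' : z != z' by rewrite eq_sym.
    have [_ oE] := h1 _ _ _ _ nz' he ht hz'.
    have [_ oE'] := h1 _ _ _ _ nz he hz' ht.
    have e1 := f1 _ _ _ _ he ht hz' nz; have e2 := f1 _ _ _ _ he hz' ht nz'.
    have nvt := split_neq hD hP ht hz' nz.
    rewrite -(crossing x y z) // in e2.
    rewrite wE in oE oE'; move: oE oE' e1 e2 nvt.
    move: (om _ z) (om _ z') (a _ z) (a _ z') => o o' az az' oE oE' e1 e2 nvt.
    rewrite oE (affine_fun2 _ _ afx) ?subrK // in e1.
    rewrite oE' (affine_fun2 _ _ afx) ?subrK // in e2.
    (* The two split points give a linear system in [A - az] and [A' - az'] with determinant $1 - o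
       - o'$. Were it zero, the two split points would coincide. *)
    have o1 : 1 - o - o' != 0.
      apply: contra_neq nvt => o0; rewrite oE oE' (_ : o' = 1 - o); last by lra.
      by rewrite subKr addrC.
    move: (bl f x y z _ _ (v z)) (bl f x y z _ _ (wpt _ _ _ _ _)) e1 e2 => A A' e1 e2.
    have {}e1 : (1 - o) * (A - az) + o * (A' - az') = 0 by lra.
    have {}e2 : (1 - o') * (A' - az') + o' * (A - az) = 0 by lra.
    have /eqP : (1 - o - o') * (A - az) = 0.
      transitivity ((1 - o') * ((1 - o) * (A - az) + o * (A' - az'))
        - o * ((1 - o') * (A' - az') + o' * (A - az))); first by ring.
      by rewrite e1 e2 !mulr0 subrr.
    by rewrite mulf_eq0 (negPf o1) subr_eq0 => /eqP.
  by rewrite key // sa // -key 1?blAC // set3AC.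
Qed.

(** Raw values of the functionals, indexed by ordered vertices. They are computed linearly from the
    Kronecker deltas of the dual basis and then rewritten as the coefficients of [has_coefs]. *)
Definition has_values f (tau : V -> V -> V -> R) (eps : V -> V -> R) :=
  [/\ blossom_C1 D P f,
      forall i j k, [set i; j; k] \in tris D ->
        bl f i j k (v i) (v j) (vt [set i; j; k]) = tau i j k
    & forall i j k, [set i; j] \in bedges D -> [set i; j; k] \in tris D ->
        bl f i j k (v i) (v j) (ve [set i; j]) = eps i j].

Lemma has_values_dual d : dof_valid D d -> has_values (B d) (dofT d) (dofE d).
Proof.
move=> hd; split; first exact: dual_C1.
  by move=> i j k ht; exact: dual_T.
by move=> i j k he ht; exact: dual_E.
Qed.

Lemma has_values_lin (c : R) f g tau tau' eps eps' :
  has_values f tau eps -> has_values g tau' eps' ->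
  has_values (fun x => c * f x + g x) (fun i j k => c * tau i j k + tau' i j k)
    (fun i j => c * eps i j + eps' i j).
Proof.
move=> [cf f1 f2] [cg g1 g2].
have [//|ch hE] := blossom_C1_lin hD hP (c := c) cf cg (h := fun x => c * f x + g x).
split=> // i j k; first by move=> ht; rewrite hE // f1 // g1.
by move=> he ht; rewrite hE // f2 // g2.
Qed.

Lemma has_values0 : has_values (fun _ => 0) (fun _ _ _ => 0) (fun _ _ => 0).
Proof.
have [//|ch hE] := blossom_C1_0 hD hP (h := fun _ => 0).
by split=> // i j k *; rewrite hE.
Qed.

Lemma has_values_ext f g tau tau' eps eps' : has_values f tau eps ->
  f =1 g ->
  (forall i j k, [set i; j; k] \in tris D -> tau i j k = tau' i j k) ->
  (forall i j k, [set i; j] \in bedges D -> [set i; j; k] \in tris D ->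
    eps i j = eps' i j) ->
  has_values g tau' eps'.
Proof.
move=> [cf f1 f2] /funext <- et ee; split=> // i j k.
  by move=> ht; rewrite f1 ?et.
by move=> he ht; rewrite f2 // (ee i j k).
Qed.

Lemma eq_set2 i j i' j' : i != j -> i' != j' ->
  ([set i; j] == [set i'; j']) = ((i == i') && (j == j')) || ((i == j') && (j == i')).
Proof.
move=> nij nij'; apply/eqP/idP => [e|/orP[]/andP[/eqP-> /eqP->] //]; last first.
  exact: finset.setUC.
have : i \in [set i'; j'] by rewrite -e !finset.inE eqxx.
have : j \in [set i'; j'] by rewrite -e !finset.inE eqxx orbT.
rewrite !finset.inE => /orP[]/eqP ej /orP[]/eqP ei; subst i j; rewrite ?eqxx ?orbT //.
  by rewrite eqxx in nij.
by rewrite eqxx in nij.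
Qed.

Lemma has_values_pair i0 j0 k0 : [set i0; j0; k0] \in tris D ->
  has_values (fun x => B (Dt i0 j0 k0) x + B (Dt j0 i0 k0) x)
    (fun i j k => (([set i; j] == [set i0; j0]) && (k == k0))%:R) (fun _ _ => 0).
Proof.
move=> ht0; have ht0' := ht0; rewrite set3C in ht0'.
have [n0 _ _] := tri_neq hD ht0.
have h := has_values_lin 1 (@has_values_dual (Dt i0 j0 k0) ht0)
  (@has_values_dual (Dt j0 i0 k0) ht0').
apply: has_values_ext h _ _ _ => [x|i j k ht|i j k _ _] /=.
- by rewrite mul1r.
- have [nij _ _] := tri_neq hD ht.
  rewrite mul1r eq_set2 // ![_ == i]eq_sym ![_ == j]eq_sym ![_ == k]eq_sym.
  by case: (i =P i0) => [->|_] /=; rewrite ?(negPf n0) /= ?addr0 ?orbF ?add0r.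
- by rewrite mulr0 addr0.
Qed.

(** The weights $1 - \omega_{ij,k}$ and $\omega_{ij,k'}$ in $B^e_{ij,k}$ are those with which its
    coefficient enters the values on the two sides of the edge. *)
Lemma Beijk_coefs i0 j0 k0 : [set i0; j0; k0] \in tris D ->
  has_coefs (Beijk D B om i0 j0 k0)
    (fun e k => ((e == [set i0; j0]) && (k == k0))%:R) (fun _ => 0).
Proof.
move=> ht0; rewrite /Beijk.
have h0 := has_values_pair ht0.
have [cf f1 f2] : has_values (Beijk D B om i0 j0 k0)
    (fun i j k => if [set i; j] == [set i0; j0]
       then if k == k0 then 1 - om [set i0; j0] k0 else om [set i0; j0] k else 0)
    (fun _ _ => 0).
  rewrite /Beijk; case: pickP => [k1 /andP[nk1 ht1]|no].
  - have h := has_values_lin (1 - om [set i0; j0] k0) h0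
      (has_values_lin (om [set i0; j0] k1) (has_values_pair ht1) has_values0).
    apply: has_values_ext h _ _ _ => [x|i j k ht|i j k _ _] /=; rewrite ?mulr0 ?addr0 //.
    case: eqP => /= [e|_]; last by rewrite !mulr0 addr0.
    rewrite e in ht; case: eqP => [->|/eqP nk] /=.
      by rewrite eq_sym (negPf nk1) mulr1 mulr0 addr0.
    (* At most two triangles share the edge, so a third vertex other than [k0] is the picked one. *)
    suff -> : k = k1 by rewrite eqxx mulr0 mulr1 add0r.
    have [he|he] := boolP ([set i0; j0] \in bedges D).
      by move: nk; rewrite (boundary_third hD he ht0 ht) eqxx.
    have {}he : [set i0; j0] \in edges D :\: bedges D.
      by rewrite finset.inE he (tri_edge hD ht0).
    have [k' [_ _ un]] := interior_third hD he ht0.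
    by rewrite (un k) // (un k1).
  - have h := has_values_lin (1 - om [set i0; j0] k0) h0 has_values0.
    apply: has_values_ext h _ _ _ => [x|i j k ht|i j k _ _] /=; rewrite ?mulr0 ?addr0 //.
    case: eqP => /= [e|_]; last by rewrite mulr0.
    rewrite e in ht; case: eqP => [_|/eqP nk] /=; first by rewrite mulr1.
    by move: (no k); rewrite nk ht.
split=> // [i j k k' he ht ht' nk|i j k he ht]; rewrite f1 //.
- case: eqP => /= [e|_]; last by rewrite !mulr0 addr0.
  rewrite e in ht ht' he *; case: (k =P k0) => [ek|/eqP nk0] /=.
    by rewrite -ek (negPf nk) mulr1 mulr0 addr0.
  have [k1 [_ _ un]] := interior_third hD he ht.
  have -> : k' = k0 by rewrite (un k') // (un k0) // eq_sym.
  by rewrite eqxx mulr0 mulr1 add0r.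
- case: eqP => /= [e|_]; last by rewrite !mulr0 addr0.
  by rewrite e in ht he *; rewrite (boundary_third hD he ht0 ht) eqxx mulr1 mulr0 addr0.
Qed.

(** The half-edge functions have value 1 at the cut point, and the weight $\omega$ in $B^e_{ij}$ is
    that of the cut point in the expression of the split point. *)
Lemma Beij_coefs i0 j0 k0 : [set i0; j0] \in bedges D -> [set i0; j0; k0] \in tris D ->
  has_coefs (Beij B om i0 j0 k0) (fun _ _ => 0) (fun e => (e == [set i0; j0])%:R).
Proof.
move=> he0 ht0; have he0' := he0; rewrite finset.setUC in he0'.
have [n0 _ _] := tri_neq hD ht0.
have h := has_values_lin 1 (@has_values_dual (De i0 j0) he0)
  (has_values_lin 1 (@has_values_dual (De j0 i0) he0')
     (has_values_lin (om [set i0; j0] k0) (has_values_pair ht0) has_values0)).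
have [cf f1 f2] : has_values (Beij B om i0 j0 k0)
    (fun i j k => om [set i0; j0] k0 * (([set i; j] == [set i0; j0]) && (k == k0))%:R)
    (fun i j => ([set i; j] == [set i0; j0])%:R).
  apply: has_values_ext h _ _ _ => [x|i j k ht|i j k he ht] /=.
  - by rewrite /Beij !mul1r addr0 addrA.
  - by rewrite !mulr0 !add0r addr0.
  - have [nij _ _] := tri_neq hD ht.
    rewrite !mul1r mulr0 !addr0 eq_set2 // ![_ == i]eq_sym ![_ == j]eq_sym.
    by case: (i =P i0) => [->|_] /=; rewrite ?(negPf n0) /= ?addr0 ?orbF ?add0r // andbC.
split=> // [i j k k' he ht ht' nk|i j k he ht]; rewrite f1 //.
- case: eqP => [e|_] /=; last by rewrite !mulr0 addr0.
  by move: he; rewrite e finset.inE he0.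
- case: eqP => [e|_] /=; last by rewrite !mulr0 addr0.
  by rewrite e in ht he *; rewrite (boundary_third hD he ht0 ht) eqxx mulr0 add0r.
Qed.

Lemma has_coefs_vertex i r : has_coefs (B (Dv i r)) (fun _ _ => 0) (fun _ => 0).
Proof.
have [cf f1 f2] := @has_values_dual (Dv i r) isT.
by split=> // [i' j k k' he ht _ _|i' j k he ht]; rewrite f1 //= !mulr0 addr0.
Qed.

Lemma reduced_basis_conditions f : reduced_basis D P B om f ->
  blossom_C1 D P f /\ reduced_conditions D P f.
Proof.
case=> [[i [r ->]]|[i [j [k [hs ->]]]]|[i [j [k [_ hk ->]]]]|[i [j [k [he ht ->]]]]].
- by apply: (reduced_conditions_coefs (has_coefs_vertex i r)).
- have ht : [set i; j; k] \in tris D by move: hs; rewrite finset.inE => /andP[].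
  have ht1 : [set j; k; i] \in tris D by rewrite set3AC set3C.
  have ht2 : [set k; i; j] \in tris D by rewrite set3C set3AC.
  apply: reduced_conditions_coefs
    (has_coefsD (has_coefsD (Beijk_coefs ht) (Beijk_coefs ht1)) (Beijk_coefs ht2)) _.
  (* For $B^t_{ijk}$ the three edge coefficients add up to the indicator of the triangle, which is
     invariant under permutations of the indices. *)
  have key i' j' k' : [set i'; j'; k'] \in tris D ->
    (([set i'; j'] == [set i; j]) && (k' == k))%:R +
    (([set i'; j'] == [set j; k]) && (k' == i))%:R +
    (([set i'; j'] == [set k; i]) && (k' == j))%:R =
    ([set i'; j'; k'] == [set i; j; k])%:R :> R.
    move=> ht'; have drop x y z : [set x; y; z] = [set i; j; k] ->
        (([set i'; j'] == [set x; y]) && (k' == z)) =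
        ([set i'; j'; k'] == [set i; j; k]) && (k' == z).
      move=> xyz; have c3 := card_tri hD ht; rewrite -xyz in c3 *.
      case: (k' =P z) => [->|_]; rewrite ?andbF ?andbT //.
      have rot a b : [set a; b; z] = [set z; a; b] by rewrite [RHS]set3C set3AC.
      apply/eqP/eqP => [->//|]; rewrite !rot in c3 *.
      move=> /(set3_inj c3)[[-> ->]//|[-> ->]].
      exact: finset.setUC.
    have e1 : [set j; k; i] = [set i; j; k] by rewrite set3AC set3C.
    have e2 : [set k; i; j] = [set i; j; k] by rewrite set3C set3AC.
    rewrite (drop i j k) // (drop j k i) // (drop k i j) //.
    have [e|_] := eqVneq [set i'; j'; k'] [set i; j; k]; last by rewrite !addr0.
    have : k' \in [set i; j; k] by rewrite -e !finset.inE eqxx orbT.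
    have [nij nik njk] := tri_neq hD ht.
    rewrite !finset.inE -orbA /= => /or3P[]/eqP ->; rewrite eqxx.
    - by rewrite (negPf nij) (negPf nik) addr0 add0r.
    - by rewrite ![j == _]eq_sym (negPf nij) eq_sym (negPf njk) !add0r.
    - by rewrite ![k == _]eq_sym (negPf nik) (negPf njk) !addr0.
  move=> i' j' k'; rewrite finset.inE => /andP[ht' _].
  by rewrite !key // -1?set3AC.
- move: hk; rewrite finset.inE => /andP[hs ht].
  apply: reduced_conditions_coefs (Beijk_coefs ht) _ => i' j' k' hs'.
  (* The coefficient is nonzero only on the triangle of the function, which is not symmetric, so it
     vanishes on both sides. *)
  case: andP => [[/eqP e /eqP ek]|_].
    by rewrite e ek in hs'; rewrite hs' in hs.
  case: andP => // -[/eqP e /eqP ek].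
  by rewrite set3AC e ek in hs'; rewrite hs' in hs.
- exact: reduced_conditions_coefs (Beij_coefs he ht) _.
Qed.

(** All the conditions are linear equations between blossom values, so they pass from the generators
    to their combinations by induction on the number of terms. *)
Lemma reduced_space_conditions f : reduced_space D P B om f ->
  blossom_C1 D P f /\ reduced_conditions D P f.
Proof.
move=> [n [a [g [hg fE]]]].
elim: n f a g hg fE => [|n IH] f a g hg fE.
  have [|cf f0] := @blossom_C1_0 _ _ _ _ hD hP f.
    by move=> x /fE ->; rewrite big_ord0.
  split=> //; split=> i j k ht.
  - by rewrite !f0 // -set3C.
  - by rewrite !f0 // -set3C.
  - have {}ht : [set i; j; k] \in tris D by move: ht; rewrite finset.inE => /andP[].
    by rewrite !f0 // -set3AC.
have [|cr [r1 r2 r3]] := IH (fun x => \sum_(l < n) a (lift ord0 l) * g (lift ord0 l) x)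
  (a \o lift ord0) (g \o lift ord0) _ (fun _ _ => erefl); first by move=> l; exact: hg.
have [cg [g1 g2 g3]] := reduced_basis_conditions (hg ord0).
have [|cf fL] := blossom_C1_lin hD hP (c := a ord0) cg cr (h := f).
  by move=> x hx; rewrite fE // big_ord_recl.
split=> //; split=> i j k ht.
- have ht' := ht; rewrite set3C in ht'.
  by rewrite !fL // g1 // r1.
- have ht' := ht; rewrite set3C in ht'.
  by rewrite !fL // g2 // r2.
- have ht1 : [set i; j; k] \in tris D by move: ht; rewrite finset.inE => /andP[].
  have ht' := ht1; rewrite set3AC in ht'.
  by rewrite !fL // g3 // r3.
Qed.

End Reduced.

Theorem theorem17 (R : realType) (V : finType) (D : mesh R V)
    (P : ps_points R V) (q : V -> 'I_3 -> plane R)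
    (B : dof V -> plane R -> R) (om : {set V} -> V -> R)
    (hD : is_triangulation D) (hP : is_PS_refinement D P)
    (hq : vertex_triangles D P q) (hB : is_dual_basis D P q B)
    (hom : is_weights D P om)
    (S : plane R -> R) (hS : reduced_space D P B om S) :
  (forall t : {set V}, t \in sym_tris D P -> C2_on_tri D P S t) /\
  (forall t : {set V}, t \in (tris D :\: sym_tris D P)%SET ->
     (forall i j : V, i \in t -> j \in t -> i != j ->
        C2_across D P S (hull [:: edge_pt P [set i; j]%SET; split_pt P t])) /\
     C2_at_split D P S t).
Proof.
have [hf rf] := reduced_space_conditions hD hP hB hom hS.
split=> t ht.
  have htri : t \in tris D by move: ht; rewrite finset.inE => /andP[].
  split=> [i it|i j it jt nij]; first exact: C2_sym_spoke.
  exact: C2_cut.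
have htri : t \in tris D by move: ht; rewrite finset.inE => /andP[].
split=> [i j it jt nij|]; first exact: C2_cut.
exact: C2_split.
Qed.
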